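(* For every graph-like continuum $X$, there is a sequence of finite graphs $(G_n)_{n\in\mathbb{N}}$, each contained in $X$ (as a topological subspace), with the following property: for every finite edge-set $F$ of $X$ and every component $C$ of $X\setminus\bigcup F$, for all but finitely many $n$ there is a unique component of $G_n\setminus\bigcup F$ meeting $C$.
   Context: A continuum is a compact, connected, non-empty metrizable space. An edge of a topological space $X$ is an open subspace $I\subseteq X$ homeomorphic to $(0,1)$ whose closure in $X$ is homeomorphic to $[0,1]$. An edge-set of $X$ is a set of pairwise disjoint edges of $X$. $X$ is graph-like if it has an edge-set $E$ such that $X\setminus\bigcup E$ is totally disconnected. A finite graph is a topological space homeomorphic to a finite simplicial 1-complex. *)

(* Defs.v *)
From mathcomp Require Import all_boot all_order all_algebra.
From mathcomp Require Import all_classical all_reals all_analysis.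

Set Implicit Arguments.
Unset Strict Implicit.
Unset Printing Implicit Defensive.

Import Order.TTheory GRing.Theory Num.Theory.
Import numFieldNormedType.Exports.

Local Open Scope classical_set_scope.
Local Open Scope ring_scope.

(* A subset [A] of a space is regarded as a space in its own right through
   [set_type A], which carries the subspace topology. *)
Definition homeomorphic (T U : topologicalType) : Prop :=
  exists (f : T -> U) (g : U -> T),
    [/\ cancel f g, cancel g f, continuous f & continuous g].

Definition metrizable (R : realType) (T : topologicalType) : Prop :=
  exists d : T -> T -> R,
    [/\ forall x y, 0 <= d x y,
        forall x y, d x y = 0 <-> x = y,
        forall x y, d x y = d y x,
        forall x y z, d x z <= d x y + d y z &
        forall (x : T) (A : set T),
          nbhs x A <-> exists2 e, 0 < e & [set y | d x y < e] `<=` A].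

Definition continuum (R : realType) (T : topologicalType) : Prop :=
  [/\ compact [set: T], connected [set: T], [set: T] !=set0 & metrizable R T].

Definition edge (R : realType) (T : topologicalType) (I : set T) : Prop :=
  [/\ open I,
      homeomorphic (set_type I) (set_type `]0 : R, 1[%classic) &
      homeomorphic (set_type (closure I)) (set_type `[0 : R, 1]%classic)].

Definition edge_set (R : realType) (T : topologicalType) (E : set (set T)) :
    Prop :=
  (forall I, E I -> edge R I) /\ trivIset E id.

Definition graph_like (R : realType) (T : topologicalType) : Prop :=
  exists2 E : set (set T), edge_set R E &
    totally_disconnected ([set: T] `\` \bigcup_(I in E) I).

(* Geometric realization in R^n of the abstract simplicial complex of dimension
   at most 1 whose vertices are the i : 'I_n and whose 1-simplices are the pairs
   {i, j} with [e i j]: vertex i is sent to the i-th standard basis vector.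
   Isolated vertices are kept, so a single point is a realization. *)
Definition realization (R : realType) (n : nat) (e : rel 'I_n) :
    set 'rV[R]_n :=
  [set p | (exists i, p = delta_mx ord0 i) \/
           (exists i j (t : R), [/\ e i j, 0 <= t <= 1 &
              p = (1 - t) *: delta_mx ord0 i + t *: delta_mx ord0 j])].
Arguments realization R {n} e.

Definition finite_graph (R : realType) (T : topologicalType) : Prop :=
  exists (n : nat) (e : rel 'I_n),
    [/\ symmetric e, irreflexive e &
        homeomorphic T (set_type (realization R e))].

Definition components (T : topologicalType) (A : set T) : set (set T) :=
  [set connected_component A x | x in A].

(* Main.v *)
(* Let E be an edge-set of X with V = X \ UE totally disconnected, and exhaust
   E by an increasing sequence of finite sets E_n. Removing finitely many edges
   leaves finitely many closed connected pieces. Join the ends of E_n that lie in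
   a common piece P of X \ UE_n by a finite tree inside P, taking P itself when it
   is an arc; G_n is the union of these trees and of the closures of the edges
   in E_n, so that G_n meets every piece in a non-empty connected set.

   The trees are made of irreducible subcontinua A between two points s, t of V.
   Each edge e that meets A splits A into a side containing s and a side
   containing t, hence yields a map phi_e : A -> [0, 1] constant on both sides.
   These maps order A consistently and separate its points, so a weighted sum of
   them embeds A into the real line.

   An edge I of F need not belong to E, but it meets some e in E, so all of I
   except two closed end segments can be chosen inside e. Attaching to a component
   C of X \ UF the end segments that start in C gives a set C' which is, up to
   points of E_n, a union of pieces of X \ UE_n. A separation of G_n /\ C would
   extend to C' and restrict to one of C. That G_n /\ C is non-empty is clear
   if C meets an edge of E; otherwise C = {c}, and if c were not in G_n then only
   one end segment could start at c, so the piece containing c would be an arc,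
   hence contained in G_n. *)
Require Import Defs.
From mathcomp Require Import all_boot all_order all_algebra.
From mathcomp Require Import all_classical all_reals all_analysis.
From mathcomp Require Import lra.

Set Implicit Arguments.
Unset Strict Implicit.
Unset Printing Implicit Defensive.

Import Order.TTheory GRing.Theory Num.Theory.
Import numFieldNormedType.Exports.

Local Open Scope classical_set_scope.
Local Open Scope ring_scope.

(* Decides pure set algebra by classical propositional logic at the point [x]. *)
Ltac at_point x :=
  repeat match goal with
  | H : subset ?A ?B |- _ =>
      let h := fresh in pose proof (H x) as h; clear H
  | H : ?A = ?B |- _ =>
      let h := fresh in
      assert (h : A x <-> B x) by (rewrite H; exact (conj id id)); clear H
  end;
  apply: contrapT; cbv [setI setU setD setC set0 mkset setT set1 subset] in *;
  tauto.

(** The graphs have to be chosen before [F] is known, and [F] may be unrelated to [E]. What serves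
    every [F] is a property of [G n] alone: it meets each piece left by [En n] in a non-empty
    connected set. A separation of the graph can then be pushed out to the space piece by piece,
    with no description of how the edges of [F] run through the pieces. Uniqueness of the component
    is obtained from the connectedness of the intersection of [G n] with [C].

    Irreducible subcontinua come from Zorn's lemma and are recognised as arcs through an injective
    real function; the argument requires both ends to lie outside every edge, so a tree is kept
    [edge_saturated] while it grows, which keeps the next attaching point out of the edges.
    Metrizability enters through the Hausdorff property and through the exhaustion of [E], without
    which the maps of the edges could not be summed with weights. *)

Lemma finite_set_ind (I : choiceType) (P : set I -> Prop) :
  P set0 -> (forall x A, finite_set A -> ~ A x -> P A -> P (x |` A)) ->
  forall A, finite_set A -> P A.
Proof.
move=> P0 PU A /finite_seqP[s ->]; elim: s => [|x s IH].
  by rewrite set_nil.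
have -> : [set` x :: s] = x |` [set` s].
  apply/seteqP; split=> y /=; rewrite inE.
    by case/orP=> [/eqP->|]; [left|right].
  by case=> [->|]; rewrite ?eqxx// => ->; rewrite orbT.
have [xs|xs] := pselect ([set` s] x).
  by rewrite setUidr// => _ ->.
exact: PU (finite_seq s) xs IH.
Qed.

(** * Connected sets *)

Section connectedness.
Context {T : topologicalType}.
Implicit Types A B K L O U W Z : set T.

Lemma connected_closedU Z K L : connected Z -> closed K -> closed L ->
  Z `<=` K `|` L -> Z `&` (K `&` L) = set0 -> Z `<=` K \/ Z `<=` L.
Proof.
move=> cZ cK cL ZKL ZKL0.
have [ZK|/existsNP[x /not_implyP[Zx nKx]]] := pselect (Z `<=` K); first by left.
right => z Zz.
suff ZL : Z `&` L = Z by rewrite -ZL in Zz; case: Zz.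
apply: cZ.
- by exists x; at_point x.
- exists (~` K); first exact: closed_openC.
  by apply/seteqP; split=> y; at_point y.
- by exists L.
Qed.

Lemma closed_connectedP A : closed A ->
  (forall K L, closed K -> closed L -> K `&` L = set0 -> A = K `|` L ->
    K !=set0 -> L !=set0 -> False) -> connected A.
Proof.
move=> cA H B [b Bb] [C oC BC] [D cD BD]; apply: contrapT => BA.
apply: (H B (A `\` B)).
- by rewrite BD; exact: closedI.
- rewrite (_ : A `\` B = A `&` ~` C); first by apply: closedI => //; exact: open_closedC.
  by apply/seteqP; split=> y; at_point y.
- by apply/seteqP; split=> y; at_point y.
- by apply/seteqP; split=> y; at_point y.
- by exists b.
- apply/set0P/negP => /eqP AB; apply: BA.
  by apply/seteqP; split=> y; at_point y.
Qed.

Lemma connected_closedC A K L : connected A -> closed K -> closed L ->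
  K `&` L = set0 -> A = K `|` L -> K !=set0 -> L = set0.
Proof.
move=> cA cK cL KL0 AKL [k Kk].
have [||AK|AL] := connected_closedU cA cK cL.
- by rewrite AKL.
- by rewrite KL0 setI0.
- by apply/seteqP; split=> y; at_point y.
- by have := AL k; at_point k.
Qed.

(* A closed piece of [A `\` O] that avoids the boundary of [O] is clopen in
   [A]; hence [A `\` O] has at most as many pieces as [O] has boundary points. *)
Lemma cut_clopen A O K L : closed A -> connected A -> open O ->
  closed K -> closed L -> K `&` L = set0 -> A `\` O = K `|` L ->
  K `&` closure O = set0 -> K !=set0 -> A `&` (O `|` L) = set0.
Proof.
move=> cA coA oO cK cL KL AKL KO K0.
have sO := @subset_closure _ O; apply: (connected_closedC coA cK) K0.
- rewrite (_ : A `&` _ = (A `&` closure O) `|` L).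
    by apply: closedU => //; apply: closedI => //; exact: closed_closure.
  by apply/seteqP; split=> y; at_point y.
- by apply/seteqP; split=> y; at_point y.
- by apply/seteqP; split=> y; at_point y.
Qed.

(** By [cut_clopen] every half of a separation of the remainder contains [u] or [v]. Two halves use
    up both points, so neither half can be split again. *)
Lemma connected_cut A O (u v : T) : closed A -> connected A -> open O ->
  closure O `\` O `<=` [set u; v] -> A `\` O !=set0 ->
  connected (A `\` O) \/
  exists K L, [/\ closed K /\ connected K, closed L /\ connected L,
    K `&` L = set0, A `\` O = K `|` L & K u /\ L v].
Proof.
move=> cA coA oO Ouv AO0; have [|nc] := pselect (connected (A `\` O)).
  by left.
right; have cAO : closed (A `\` O).
  by apply: closedI => //; exact: open_closedC.
have meet K L : closed K -> closed L -> K `&` L = set0 -> A `\` O = K `|` L ->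
    K !=set0 -> L !=set0 -> K u \/ K v.
  move=> cK cL KL AKL K0 [l Ll]; apply: contrapT => /not_orP[nu nv].
  have KO : K `&` closure O = set0.
    rewrite -subset0 => y [Ky Oy]; have [] : [set u; v] y.
    - by have := Ouv y; at_point y.
    - by move=> yu; rewrite yu in Ky.
    - by move=> yv; rewrite yv in Ky.
  by have e := cut_clopen cA coA oO cK cL KL AKL KO K0; at_point l.
(* Each part of a splitting of [K] is itself half of a separation, the other part being added to
   [L]. So both parts need a boundary point, but [K] has only one. *)
have conn K L : closed K -> closed L -> K `&` L = set0 -> A `\` O = K `|` L ->
    K !=set0 -> L !=set0 -> (~ K v \/ ~ K u) -> connected K.
  move=> cK cL KL AKL K0 L0 Kuv; apply: closed_connectedP => //.
  move=> K1 K2 cK1 cK2 K12 KE K10 K20.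
  have h1 : K1 u \/ K1 v.
    apply: (@meet _ (K2 `|` L)) => //; first exact: closedU.
    - by apply/seteqP; split=> y; at_point y.
    - by apply/seteqP; split=> y; at_point y.
    - by case: K20 => k ?; exists k; left.
  have h2 : K2 u \/ K2 v.
    apply: (@meet _ (K1 `|` L)) => //; first exact: closedU.
    - by apply/seteqP; split=> y; at_point y.
    - by apply/seteqP; split=> y; at_point y.
    - by case: K10 => k ?; exists k; left.
  have sK : K1 `<=` K by rewrite KE; exact: subsetUl.
  have sK' : K2 `<=` K by rewrite KE; exact: subsetUr.
  have n x : K1 x -> K2 x -> False.
    by move=> *; at_point x.
  move: (sK u) (sK' u) (sK v) (sK' v).
  move: (n u) (n v).
  tauto.
have [K [L [[cK cL KL AKL] [K0 L0]]]] : exists K L, [/\ closed K, closed L,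
    K `&` L = set0 & A `\` O = K `|` L] /\ K !=set0 /\ L !=set0.
  apply: contrapT => H; apply: nc; apply: closed_connectedP => // K L *.
  by apply: H; exists K, L.
have LK : L `&` K = set0 by rewrite setIC.
have ALK : A `\` O = L `|` K by rewrite setUC.
have mK := meet _ _ cK cL KL AKL K0 L0.
have mL := meet _ _ cL cK LK ALK L0 K0.
have h x : K x -> L x -> False.
  by move=> ? ?; have : (K `&` L) x; [|rewrite KL].
have [[Ku Lv]|[Kv Lu]] : (K u /\ L v) \/ (K v /\ L u).
- by move: (h u) (h v); tauto.
- exists K, L; split => //; split=> //.
    by apply: (conn K L) => //; left => /h; exact.
  by apply: (conn L K) => //; right => ?; exact: (h u).
- exists L, K; split => //; split=> //.
    by apply: (conn L K) => //; left => ?; exact: (h v).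
  by apply: (conn K L) => //; right => /h; exact.
Qed.

End connectedness.

(** * Pieces left after removing finitely many edges *)

Section pieces.
Context {T : topologicalType}.
Implicit Types A B K L O U W Z Y : set T.
Implicit Types D E F : set (set T).

(** Finitely many disjoint closed connected sets are the components of their union, so [D] is
    determined by [Y]. Listing them explicitly allows one piece at a time to be replaced. *)
Definition pieces Y D :=
  [/\ finite_set D, forall P, D P -> [/\ closed P, connected P & P !=set0],
      trivIset D id & Y = \bigcup_(P in D) P].

(** The part of being an edge that cutting arguments use: no parametrization, only two boundary
    points. *)
Definition edge_like O :=
  [/\ open O, connected O, O !=set0 &
    exists u v, closure O = O `|` [set u; v] /\ [/\ ~ O u, ~ O v & u <> v]].

Lemma pieces_rest_closed Y D P : pieces Y D ->
  closed (\bigcup_(Q in D `\ P) Q).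
Proof.
move=> [fD DP _ _]; apply: closed_bigcup => [|Q [/DP[]//]].
exact: finite_setD.
Qed.

Lemma connected_sub_piece Y D P Z : pieces Y D -> D P -> connected Z ->
  Z `<=` Y -> Z `&` P !=set0 -> Z `<=` P.
Proof.
move=> pD DP cZ ZY [z [Zz Pz]].
have cR := pieces_rest_closed (P := P) pD.
case: pD => fD hD tD YE; have [cP _ _] := hD _ DP.
have PR : P `&` (\bigcup_(Q in D `\ P) Q) = set0.
  rewrite -subset0 => y [Py [Q [DQ QP] Qy]].
  by apply: QP; apply: tD => //; exists y.
have [||//|] := connected_closedU cZ cP cR.
- move=> y /ZY; rewrite YE => -[Q DQ Qy].
  have [QP|QP] := pselect (Q = P); first by left; rewrite -QP.
  by right; exists Q.
- by rewrite PR setI0.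
- by move=> /(_ z Zz) Rz; have : (P `&` \bigcup_(Q in D `\ P) Q) z by []; rewrite PR.
Qed.

Lemma component_piece Y D C : pieces Y D -> components Y C -> D C.
Proof.
move=> pD [x Yx <-]; have [P DP Px] : (\bigcup_(P in D) P) x.
  by case: pD => _ _ _ <-.
suff -> : connected_component Y x = P by [].
apply/seteqP; split.
  apply: (connected_sub_piece pD DP).
  - exact: component_connected.
  - exact: connected_component_sub.
  - by exists x; split => //; exact: connected_component_refl.
case: pD => _ hD _ YE; case: (hD _ DP) => _ cP _.
by apply: connected_component_max => //; rewrite YE => y Py; exists P.
Qed.

Lemma pieces_setD Y D P P' D' : pieces Y D -> D P ->
  pieces P' D' -> P' `<=` P ->
  pieces (Y `\` (P `\` P')) ((D `\ P) `|` D').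
Proof.
move=> [fD hD tD YE] DP [fD' hD' tD' PE] PP'; split.
- by rewrite finite_setU; split => //; exact: finite_setD.
- by move=> Q [[/hD]|/hD'].
- move=> Q1 Q2 [[DQ1 n1]|DQ1] [[DQ2 n2]|DQ2] Q12; do ?[exact: tD|exact: tD'].
  + exfalso; case: Q12 => y [Q1y Q2y]; apply: n1; apply: tD => //.
    by exists y; split => //; apply: PP'; rewrite PE; exists Q2.
  + exfalso; case: Q12 => y [Q1y Q2y]; apply: n2; apply: tD => //.
    by exists y; split => //; apply: PP'; rewrite PE; exists Q1.
- apply/seteqP; split=> y.
    rewrite YE => -[[Q DQ Qy] nP].
    have [P'y|nP'y] := pselect (P' y).
      by move: P'y; rewrite PE => -[Q' D'Q' Q'y]; exists Q' => //; right.
    exists Q => //; left; split => // QP.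
    by rewrite /= QP in Qy; apply: nP.
  move=> [Q [[DQ nQ]|DQ'] Qy].
    split; first by rewrite YE; exists Q.
    by move=> [Py _]; apply: nQ; apply: tD => //; exists y.
  have P'y : P' y by rewrite PE; exists Q.
  by split; [rewrite YE; exists P => //; exact: PP'|move=> []].
Qed.

Lemma pieces_connected Y : closed Y -> connected Y -> Y !=set0 ->
  pieces Y [set Y].
Proof.
move=> cY coY Y0; split.
- exact: finite_set1.
- by move=> _ ->.
- by move=> ? ? -> ->.
- by rewrite bigcup_set1.
Qed.

Lemma edge_like_bnd O : edge_like O ->
  exists u v, [/\ closure O `\` O `<=` [set u; v], closure O u, closure O v,
   ~ O u & ~ O v /\ u <> v].
Proof.
move=> [_ _ _ [u [v [E [nu nv uv]]]]]; exists u, v; rewrite E; split => //.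
- by move=> y [[]].
- by right; left.
- by right; right.
Qed.

(** Induction on the edges: the next edge is connected, hence inside a single piece, and having two
    boundary points it leaves one or two pieces of it. *)
Lemma pieces_edges E : connected [set: T] -> [set: T] !=set0 ->
  finite_set E -> (forall O, E O -> edge_like O) -> trivIset E id ->
  exists D, pieces ([set: T] `\` \bigcup_(O in E) O) D.
Proof.
move=> cT T0 fE; elim/finite_set_ind : E / fE => [_ _|O E fE nEO IH hE tE].
  by rewrite bigcup_set0 setD0; exists [set [set: T]]; exact: pieces_connected.
have [||D pD] := IH; first by move=> ? ?; apply: hE; right.
  by apply: sub_trivIset tE => ? ?; right.
have eO : edge_like O by apply: hE; left.
have [oO cO [p Op] _] := eO.
have OE : O `<=` [set: T] `\` \bigcup_(O in E) O.
  move=> y Oy; split => // -[Q EQ Qy]; apply: nEO.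
  rewrite (_ : O = Q) //; apply: tE; [by left|by right|by exists y].
have [P DP Pp] : (\bigcup_(P in D) P) p.
  by case: pD => _ _ _ <-; exact: OE.
have OP : O `<=` P.
  by apply: (connected_sub_piece pD) => //; exists p.
have [u [v [Ouv cu cv nu [nv uv]]]] := edge_like_bnd eO.
have [cP coP _] : [/\ closed P, connected P & P !=set0] by case: pD => _ + _ _; exact.
have sOP : closure O `<=` P.
  by rewrite [P](closure_id _).1//; exact: closureS.
have PO0 : P `\` O !=set0 by exists u; split => //; exact: sOP.
have [D' pD'] : exists D', pieces (P `\` O) D'.
  have [cPO|[K [L [[cK coK] [cL coL] KL POE [Ku Lv]]]]] := connected_cut cP coP oO Ouv PO0.
    exists [set P `\` O]; apply: pieces_connected => //.
    by apply: closedI => //; exact: open_closedC.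
  exists [set K; L]; split; first exact: finite_set2.
  - by move=> Q [] -> ; split => //; [exists u|exists v].
  - by move=> Q1 Q2 [] -> [] -> //=; rewrite ?KL ?(setIC L K) ?KL => -[].
  - rewrite POE; apply/seteqP; split=> y.
      by move=> [?|?]; [exists K => //; left|exists L => //; right].
    by move=> [_ [->|->]]; [left|right].
exists ((D `\ P) `|` D').
have -> : [set: T] `\` \bigcup_(Q in O |` E) Q =
    ([set: T] `\` \bigcup_(Q in E) Q) `\` (P `\` (P `\` O)).
  rewrite bigcup_setU bigcup_set1.
  by apply/seteqP; split => y; at_point y.
by apply: pieces_setD pD' _ => // y [].
Qed.

End pieces.


(** * Irreducible subcontinua *)

Section compact_hausdorff.
Context {T : topologicalType} (cptT : compact [set: T]) (hT : hausdorff_space T).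
Implicit Types A B K L O U W Z Y : set T.

Lemma separate_closed A B : closed A -> closed B -> A `&` B = set0 ->
  exists U W, [/\ open U, open W, A `<=` U, B `<=` W & U `&` W = set0].
Proof.
move=> cA cB AB.
have /(compact_normal hT cptT cA)[C /set_nbhsP[U [oU AU UC]] CB] : set_nbhs A (~` B).
  apply/set_nbhsP; exists (~` B); split => //; first exact: closed_openC.
  by move=> y; at_point y.
exists U, (~` closure C); split => //.
- exact/closed_openC/closed_closure.
- by move=> y; at_point y.
- have sC := @subset_closure _ C.
  by apply/seteqP; split => y; at_point y.
Qed.

Lemma chain_sub (F : set (set T)) U : F !=set0 -> (forall A, F A -> closed A) ->
  total_on F subset -> open U -> \bigcap_(A in F) A `<=` U ->
  exists2 A, F A & A `<=` U.
Proof.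
move=> [A0 FA0] cF tF oU FU; apply: contrapT => nF.
pose G := filter_from F (fun A => A `\` U).
have PG : ProperFilter G.
  apply: filter_from_proper; first apply: filter_from_filter.
  - by exists A0.
  - move=> A B FA FB; have [AB|BA] := tF _ _ FA FB.
      by exists A => // y; at_point y.
    by exists B => // y; at_point y.
  - move=> A FA; apply/set0P/negP => /eqP AU; apply: nF; exists A => // y.
    by at_point y.
have [|x [_ clx]] := cptT PG; first exact: filterT.
have xA A : F A -> A x /\ ~ U x.
  move=> FA; have : closed (A `\` U).
    by apply: closedI; [exact: cF|exact: open_closedC].
  rewrite closure_id => AE; suff : (A `\` U) x by [].
  rewrite AE => B nB; apply: clx => //.
  by exists A.
have [_ nUx] := xA _ FA0; apply: nUx; apply: FU => A FA.
by have [] := xA _ FA.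
Qed.

(** The quasi-component version of a connection from [s] to [Z]. Unlike connectedness it passes
    directly to intersections of chains of closed sets, so Zorn's lemma is applied to it; minimal
    sets then turn out to be connected. *)
Definition joined K (s : T) Z := forall A B, closed A -> closed B ->
  A `&` B = set0 -> K = A `|` B -> A s -> A `&` Z !=set0.

Lemma joined_connected K s Z : connected K -> K s -> K `&` Z !=set0 ->
  joined K s Z.
Proof.
move=> cK Ks KZ A B cA cB AB KE As.
have B0 : B = set0.
  by apply: (connected_closedC cK cA cB) => //; exists s.
by rewrite KE B0 setU0 in KZ.
Qed.

Lemma irreducible K s Z : closed K -> K s -> closed Z -> joined K s Z ->
  exists A, [/\ A `<=` K, closed A, connected A, A s & A `&` Z !=set0] /\
    forall B, B `<=` A -> closed B -> connected B -> B s -> B `&` Z !=set0 ->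
    B = A.
Proof.
move=> cK Ks cZ jK.
(* [Zorn_bigcup] speaks of unions, so the search runs over the open sets to be removed from [K]. *)
pose P U := [/\ open U, ~ U s & joined (K `\` U) s Z].
have [F FP totF|U [[oU Us jU] Umax]] := @Zorn_bigcup T P.
  have [F0|nF] := pselect (F !=set0); last first.
    have -> : F = set0 by apply/seteqP; split=> // U FU; apply: nF; exists U.
    by rewrite bigcup_set0; split; [exact: open0|by []|rewrite setD0].
  split; first by apply: bigcup_open => U /FP[].
    by move=> [U /FP[]].
  move=> A B cA cB AB KE As; apply: contrapT => /set0P/negP/negPn/eqP AZ.
  (* A separation of the intersection spreads to some [K \ V] in the chain. [Z] is put on the side
     of [B], so that the part of [K \ V] inside [U] still misses [Z]. *)
  have [||U [W [oU oW AU BW UW]]] := @separate_closed A (B `|` Z) cA.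
  - exact: closedU.
  - by apply/seteqP; split=> y; at_point y.
  have [|||||_ [V FV <-] VU] := @chain_sub ((fun V => K `\` V) @` F) (U `|` W).
  - by case: F0 => V FV; exists (K `\` V), V.
  - move=> _ [V /FP[oV _ _] <-]; apply: closedI => //; exact: open_closedC.
  - move=> _ _ [V1 FV1 <-] [V2 FV2 <-]; have [V12|V21] := totF _ _ FV1 FV2.
      by right=> y; at_point y.
    by left=> y; at_point y.
  - exact: openU.
  - move=> y Fy; have : (K `\` \bigcup_(V in F) V) y.
      split; first by case: F0 => V FV; case: (Fy (K `\` V)) => //; exists V.
      by move=> [V FV Vy]; case: (Fy (K `\` V)) => //; exists V.
    by rewrite KE => -[/AU|By]; [left|right; apply: BW; left].
  have [oV Vs jV] := FP _ FV.
  have cV : closed (K `\` V) by apply: closedI => //; exact: open_closedC.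
  have [||||| y [+ Zy]] := jV ((K `\` V) `\` W) ((K `\` V) `\` U).
  - by apply: closedI => //; exact: open_closedC.
  - by apply: closedI => //; exact: open_closedC.
  - by clear KE; apply/seteqP; split=> y; at_point y.
  - by clear KE; apply/seteqP; split=> y; at_point y.
  - by clear KE; at_point s.
  - by move=> [_]; apply; apply: BW; right.
have min B : B `<=` K `\` U -> closed B -> B s -> joined B s Z -> B = K `\` U.
  move=> BU cB Bs jB; apply: contrapT => nBU.
  apply: (Umax (~` B)).
    split; first by move=> y; at_point y.
    by move=> UB; apply: nBU; apply/seteqP; split=> y; at_point y.
  split; [exact: closed_openC|by move=> /(_ Bs)|].
  rewrite (_ : K `\` ~` B = B) //.
  by apply/seteqP; split=> y; at_point y.
have cU : closed (K `\` U) by apply: closedI => //; exact: open_closedC.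
(* If the minimal set split, the half containing [s] would still be joined to [Z], against
   minimality. *)
have coU : connected (K `\` U).
  have sep A B : closed A -> closed B -> A `&` B = set0 ->
      K `\` U = A `|` B -> A s -> B !=set0 -> False.
    move=> cA cB AB UE As [b Bb].
    have AU : A = K `\` U.
      apply: min => //; first by rewrite UE; exact: subsetUl.
      move=> A1 A2 cA1 cA2 A12 AE A1s.
      apply: (jU A1 (A2 `|` B)) => //; first exact: closedU.
        by apply/seteqP; split => y; at_point y.
      by apply/seteqP; split => y; at_point y.
    by at_point b.
  apply: closed_connectedP => // A B cA cB AB UE A0 B0.
  have : (K `\` U) s by []; rewrite UE => -[As|Bs].
    exact: (sep A B).
  by apply: (sep B A) => //; [rewrite setIC|rewrite setUC].
exists (K `\` U); split.
  split => //.
  by apply: (jU _ set0) => //; [exact: closed0|rewrite setI0|rewrite setU0].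
by move=> B BU cB coB Bs BZ; apply: min => //; exact: joined_connected.
Qed.

End compact_hausdorff.

Lemma compact_finite_subcover (T : topologicalType) (I : Type) (K : set T)
    (D : set I) (f : I -> set T) : compact K -> (forall i, D i -> open (f i)) ->
  K `<=` \bigcup_(i in D) f i ->
  exists D', [/\ finite_set D', D' `<=` D & K `<=` \bigcup_(i in D') f i].
Proof.
move=> cK oF KD; apply: contrapT => nfin.
pose G := filter_from [set D' | finite_set D' /\ D' `<=` D]
  (fun D' => K `\` \bigcup_(i in D') f i).
have PG : ProperFilter G.
  apply: filter_from_proper; first apply: filter_from_filter.
  - by exists set0; split; [exact: finite_set0|exact: sub0set].
  - move=> A B [fA AD] [fB BD]; exists (A `|` B).
      by split; [rewrite finite_setU|rewrite subUset].
    by move=> x [Kx nx]; split; split => // -[i Ai fx]; apply: nx; exists i => //;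
      [left|right].
  - move=> A [fA AD]; apply/set0P/negP => /eqP KA; apply: nfin; exists A.
    by split => // y; at_point y.
have [|x [Kx clx]] := cK G PG.
  exists set0; first by split; [exact: finite_set0|exact: sub0set].
  by move=> y [].
have [i Di fx] := KD x Kx.
have [||y [[_ ny] fy]] := clx (K `\` \bigcup_(j in [set i]) f j) (f i).
- by exists [set i] => //; split; [exact: finite_set1|move=> _ ->].
- by apply: open_nbhs_nbhs; split => //; exact: oF.
- by apply: ny; exists i.
Qed.

(** * Exhausting an edge-set by finite sets *)

Section metric.
Context {R : realType} {T : topologicalType} (mT : metrizable R T).

Lemma metrizable_hausdorff : hausdorff_space T.
Proof.
have [d [d0 deq dsym dtri dn]] := mT.
move=> x y clxy; apply: contrapT => /eqP xy.
have dxy : 0 < d x y / 2.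
  rewrite divr_gt0// lt_neqAle d0 andbT eq_sym; apply/eqP => /deq/eqP.
  exact/negP.
have [|| z [/= xz yz]] := clxy [set z | d x z < d x y / 2] [set z | d y z < d x y / 2].
- by apply/dn; exists (d x y / 2).
- by apply/dn; exists (d x y / 2).
have := le_lt_trans (dtri x z y) (ltrD xz _); rewrite dsym in yz.
by move=> /(_ _ yz); rewrite -splitr ltxx.
Qed.

Lemma countable_net : compact [set: T] -> exists N : nat -> set T,
  (forall n, finite_set (N n)) /\
  forall U, open U -> U !=set0 -> exists n, U `&` N n !=set0.
Proof.
have [d [d0 deq dsym dtri dn]] := mT.
move=> cT.
pose f n (x : T) := [set y | d x y < n.+1%:R^-1 :> R]°.
have fin n : exists N, finite_set N /\ [set: T] `<=` \bigcup_(x in N) f n x.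
  have [||N [fN _ TN]] := @compact_finite_subcover _ _ _ setT (f n) cT.
  - by move=> x _; exact: open_interior.
  - move=> x _; exists x => //; apply/dn.
    by exists n.+1%:R^-1; [rewrite invr_gt0 ltr0n|].
  - by exists N; split.
have [N NP] := choice fin.
exists N; split=> [n|U oU [x Ux]]; first by have [] := NP n.
have /dn[e e0 eU] : nbhs x U by apply: open_nbhs_nbhs.
have [n ne] : exists n, n.+1%:R^-1 < e.
  by have [n _ h] := near_infty_natSinv_lt (PosNum e0); exists n; exact: h (leqnn n).
have [_ TN] := NP n; have [y Ny /interior_subset/= dyx] := TN x I.
by exists n, y; split => //; apply: eU; rewrite /= dsym; exact: lt_trans ne.
Qed.

Lemma finite_meet (E : set (set T)) N : trivIset E id -> finite_set N ->
  finite_set [set e | E e /\ e `&` N !=set0].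
Proof.
move=> tE fN; pose g x := xget set0 [set e | E e /\ e x].
apply: (@sub_finite_set _ _ (g @` N)); last exact: finite_image.
move=> e [Ee [x [ex Nx]]]; exists x => //; rewrite /g.
case: xgetP => [e' _ [Ee' e'x]|/(_ e) []//].
by apply: tE => //; exists x.
Qed.

(** A finite set meets only finitely many of the disjoint sets in [E], and every non-empty open set
    meets one of the finite nets; stage [n] takes the edges met by the nets up to [n]. *)
Lemma edge_exhaustion (E : set (set T)) : compact [set: T] ->
  trivIset E id -> (forall e, E e -> open e /\ e !=set0) ->
  exists En : nat -> set (set T), [/\ forall n, finite_set (En n),
    forall n, En n `<=` E, forall n m, (n <= m)%N -> En n `<=` En m &
    forall e, E e -> exists n, En n e].
Proof.
move=> /countable_net[N [fN hN]] tE hE.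
exists (fun n => [set e | E e /\ exists2 m, (m <= n)%N & e `&` N m !=set0]).
split.
- move=> n; have : finite_set (\bigcup_(m in `I_n.+1) N m).
    exact: bigcup_finite.
  move/(finite_meet tE); apply: sub_finite_set => e [Ee [m mn [x [ex Nx]]]].
  by split => //; exists x; split => //; exists m.
- by move=> n e [].
- move=> n m nm e [Ee [k kn ek]]; split => //; exists k => //.
  exact: leq_trans nm.
- move=> e Ee; have [oe e0] := hE _ Ee; have [n en] := hN _ oe e0.
  by exists n; split => //; exists n.
Qed.

End metric.

(** * Separating points by removing finitely many edges *)

Section separation.
Context {T : topologicalType} (cptT : compact [set: T]) (hT : hausdorff_space T).

(** Components and quasi-components agree here: if [x] could not be separated from [y], then
    [irreducible] with [Z] the point [y] would give a connected subset of [V] containing both. *)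
Lemma disconnected_separation (V : set T) x y : closed V -> totally_disconnected V ->
  V x -> V y -> x <> y ->
  exists A B, [/\ closed A, closed B, A `&` B = set0, V = A `|` B & A x /\ B y].
Proof.
move=> cV tV Vx Vy xy; apply: contrapT => nsep.
have cy : closed [set y] by exact/accessible_closed_set1/hausdorff_accessible.
have [|A [[AV cA coA Ax [z [Az zy]]] _]] := irreducible cptT hT cV Vx cy.
  move=> A B cA cB AB VAB Ax; apply: contrapT => Ay; apply: nsep.
  exists A, B; split => //; split => //.
  have : V y by []; rewrite VAB => -[Ay'|//].
  by exfalso; apply: Ay; exists y.
have : connected_component V x y by exists A => //; rewrite zy in Az.
by rewrite tV// => yx; apply: xy.
Qed.

(** Disjoint open neighbourhoods of the two halves of [V] leave a compact remainder that is covered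
    by edges, hence by finitely many. *)
Lemma edges_separation (E : set (set T)) x y : (forall e, E e -> open e) ->
  let V := [set: T] `\` \bigcup_(e in E) e in
  totally_disconnected V -> V x -> V y -> x <> y ->
  exists E' K L, [/\ finite_set E' /\ E' `<=` E, closed K, closed L,
    K `&` L = set0 & [/\ [set: T] `\` \bigcup_(e in E') e = K `|` L, K x & L y]].
Proof.
move=> oE V tV Vx Vy xy.
have cV : closed V.
  by apply: closedI; [exact: closedT|apply: open_closedC; exact: bigcup_open].
have [A [B [cA cB AB VAB [Ax By]]]] := disconnected_separation cV tV Vx Vy xy.
have [U [W [oU oW AU BW UW]]] := separate_closed cptT hT cA cB AB.
have : compact ([set: T] `\` (U `|` W)).
  apply: (subclosed_compact _ cptT) => //; apply: closedI; first exact: closedT.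
  by apply: open_closedC; exact: openU.
move=> /compact_finite_subcover /(_ oE)[|E' [fE' E'E UWE']].
  move=> z [_ nz]; apply: contrapT => nE; apply: nz.
  have : V z by [].
  by rewrite VAB => -[/AU|/BW]; [left|right].
exists E'.
have cE' : closed ([set: T] `\` \bigcup_(e in E') e).
  apply: closedI; first exact: closedT; apply: open_closedC; apply: bigcup_open.
  by move=> e eE'; apply: oE; exact: E'E.
have VE' : V `<=` [set: T] `\` \bigcup_(e in E') e.
  move=> z [_ nz]; split=> // -[e eE' ez]; apply: nz; exists e => //.
  exact: E'E.
exists (([set: T] `\` \bigcup_(e in E') e) `\` W).
exists (([set: T] `\` \bigcup_(e in E') e) `\` U).
split.
- by [].
- by apply: closedI => //; exact: open_closedC.
- by apply: closedI => //; exact: open_closedC.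
- apply/seteqP; split=> z; at_point z.
- split.
  + by apply/seteqP; split=> z; at_point z.
  + by split; [exact: VE'|move=> Wx; have := congr1 (@^~ x) UW; at_point x].
  + by split; [exact: VE'|at_point y].
Qed.
End separation.

(** * Arcs and edges *)

Lemma within_closedP (U : topologicalType) (V : topologicalType) (A : set U)
    (f : U -> V) : closed A ->
  {within A, continuous f} <-> forall C, closed C -> closed (A `&` f @^-1` C).
Proof.
move=> cA; rewrite continuous_closedP.
by split=> H C cC; have := H C cC; rewrite closed_setSI.
Qed.

Lemma homeomorphic_within (U V : topologicalType) (A : set U) (B : set V) :
  homeomorphic (set_type A) (set_type B) -> A !=set0 -> B !=set0 ->
  exists f g, [/\ {within A, continuous f}, {within B, continuous g},
    forall x, A x -> B (f x), forall y, B y -> A (g y) &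
    (forall x, A x -> g (f x) = x) /\ (forall y, B y -> f (g y) = y)].
Proof.
move=> [F [G [FK GK cF cG]]] [x0 Ax0] [y0 By0].
pose f := valL_ y0 (set_val \o F); pose g := valL_ x0 (set_val \o G).
have fE (z : A) : f (set_val z) = set_val (F z).
  have /(congr1 (@^~ z)) := valLK y0 (set_val \o F).
  by rewrite /sigL.
have gE (z : B) : g (set_val z) = set_val (G z).
  have /(congr1 (@^~ z)) := valLK x0 (set_val \o G).
  by rewrite /sigL.
have AE x : A x -> exists z : A, x = set_val z.
  by move=> Ax; exists (SigSub (mem_set Ax)).
have BE y : B y -> exists z : B, y = set_val z.
  by move=> Bx; exists (SigSub (mem_set Bx)).
exists f, g; split.
- apply/subspace_valL_continuousP' => x; apply: continuous_comp; first exact: cF.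
  exact: initial_continuous.
- apply/subspace_valL_continuousP' => x; apply: continuous_comp; first exact: cG.
  exact: initial_continuous.
- by move=> x /AE[z ->]; rewrite fE; exact: set_valP.
- by move=> x /BE[z ->]; rewrite gE; exact: set_valP.
- split.
  + by move=> x /AE[z ->]; rewrite fE gE FK.
  + by move=> x /BE[z ->]; rewrite gE fE GK.
Qed.

Section arcs.
Context {R : realType} {T : topologicalType}.
Implicit Types (A B I : set T) (f : T -> R).

(** The coordinate runs from the arc to [[0, 1]], so subarcs are preimages of intervals and
    coordinates can be glued. Continuity of the inverse is automatic in a compact space
    ([arc_inv]). *)
Definition is_arc A f a b :=
  [/\ closed A, {within A, continuous f},
      forall x y, A x -> A y -> f x = f y -> x = y,
      f @` A = `[0, 1]%classic &
      [/\ A a, A b, f a = 0 & f b = 1]].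

Lemma arc_closed A f a b : is_arc A f a b -> closed A.
Proof. by case. Qed.

Lemma arc_itv A f a b x : is_arc A f a b -> A x -> 0 <= f x <= 1.
Proof.
move=> [_ _ _ fA _] Ax; have : (f @` A) (f x) by exists x.
by rewrite fA /= in_itv.
Qed.

Lemma arc_preimage A f a b t : is_arc A f a b -> 0 <= t <= 1 ->
  exists2 x, A x & f x = t.
Proof.
move=> [_ _ _ fA _] t01; have : (f @` A) t by rewrite fA /= in_itv.
by case=> x Ax <-; exists x.
Qed.

Lemma arc_neq A f a b : is_arc A f a b -> a <> b.
Proof.
move=> [_ _ _ _ [_ _ fa fb]] ab; rewrite ab fb in fa.
by move/eqP : fa; rewrite oner_eq0.
Qed.

Lemma arc_rev A f a b : is_arc A f a b -> is_arc A (fun x => 1 - f x) b a.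
Proof.
move=> hA; have [cA cf If fA [Aa Ab fa fb]] := hA; split => //.
- move=> x; apply: cvgB; first exact: cvg_cst.
  exact: cf.
- by move=> x y Ax Ay /(congr1 (fun t => 1 - t)); rewrite !subKr; exact: If.
- apply/seteqP; split=> t.
    move=> [x /(arc_itv hA)/andP[f0 f1] <-]; rewrite /= in_itv /=.
    by rewrite subr_ge0 f1 lerBlDr lerDl.
  rewrite /= in_itv /= => /andP[t0 t1].
  have [|x Ax fx] := arc_preimage (t := 1 - t) hA.
    by rewrite subr_ge0 t1 lerBlDr lerDl.
  by exists x; rewrite // fx subKr.
- by split; rewrite // ?fa ?fb ?subr0 ?subrr.
Qed.

Lemma subarc A f a b x y : is_arc A f a b -> A x -> A y -> f x < f y ->
  is_arc (A `&` f @^-1` `[f x, f y]) (fun z => (f z - f x) / (f y - f x)) x y.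
Proof.
move=> hA Ax Ay xy; have [cA cf If fA _] := hA.
have d0 : 0 < f y - f x by rewrite subr_gt0.
have dn0 : f y - f x != 0 by rewrite gt_eqF.
have cS : closed (A `&` f @^-1` `[f x, f y]).
  by move/within_closedP : cf; apply => //; exact: interval_closed.
split => //.
- apply: (@continuous_subspaceW _ _ _ A); first exact: subIsetl.
  move=> z; apply: cvgM; last exact: cvg_cst.
  by apply: cvgB; [exact: cf|exact: cvg_cst].
- move=> u v [Au _] [Av _] /(congr1 (fun t => t * (f y - f x))).
  by rewrite !mulfVK// => /addIr; exact: If.
- apply/seteqP; split=> t.
    move=> [z [Az /=]]; rewrite !in_itv /= => /andP[h1 h2] <-.
    rewrite divr_ge0 ?subr_ge0 ?(ltW xy)//=.
    by rewrite ler_pdivrMr// mul1r lerD2r.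
  rewrite /= in_itv /= => /andP[t0 t1].
  have [fx0 fx1] := andP (arc_itv hA Ax); have [fy0 fy1] := andP (arc_itv hA Ay).
  have h1 : f x <= f x + t * (f y - f x) by rewrite lerDl mulr_ge0// ltW.
  have h2 : f x + t * (f y - f x) <= f y.
    by rewrite -lerBrDl -[leRHS]mul1r ler_wpM2r// ltW.
  have [|z Az fz] := arc_preimage (t := f x + t * (f y - f x)) hA.
    by rewrite (le_trans fx0 h1) (le_trans h2 fy1).
  exists z; first by split => //=; rewrite in_itv /= fz h1 h2.
  by rewrite fz addrC addKr mulfK.
- split => /=; rewrite ?in_itv /= ?lexx ?(ltW xy)// ?subrr ?mul0r//.
  by rewrite divff.
Qed.

Context (cptT : compact [set: T]).

Lemma closed_cpt A : closed A -> compact A.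
Proof. by move=> cA; exact: (subclosed_compact cA cptT). Qed.

Lemma arc_inv A f a b : is_arc A f a b -> exists g : R -> T,
  [/\ {within `[0 : R, 1], continuous g}, forall t, 0 <= t <= 1 -> A (g t),
    forall x, A x -> g (f x) = x & forall t, 0 <= t <= 1 -> f (g t) = t].
Proof.
move=> hA; have [cA cf If fA _] := hA.
pose g t := xget a [set x | A x /\ f x = t].
have gP t : 0 <= t <= 1 -> A (g t) /\ f (g t) = t.
  move=> t01; rewrite /g; case: xgetP => [x _ //|].
  by have [x Ax fx] := arc_preimage hA t01; move/(_ x) => [].
exists g; split.
- apply/within_closedP; first exact: interval_closed.
  move=> C cC; have -> : `[0, 1]%classic `&` g @^-1` C = f @` (A `&` C).
    apply/seteqP; split=> [t [] /=|t [x [Ax Cx] <-]].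
      by rewrite in_itv /= => /gP[Ag fg] Cg; exists (g t).
    have x01 := arc_itv hA Ax; split; first by rewrite /= in_itv.
    by have [Ag fg] := gP _ x01; rewrite /= (If _ _ Ag Ax fg).
  apply: compact_closed; first exact: Rhausdorff.
  apply: continuous_compact; last by apply: closed_cpt; exact: closedI.
  exact: continuous_subspaceW cf.
- by move=> t /gP[].
- move=> x Ax; have [Ag fg] := gP _ (arc_itv hA Ax); exact: If.
- by move=> t /gP[].
Qed.

Lemma arc_connected A f a b (J : set R) : is_arc A f a b -> is_interval J ->
  connected (A `&` f @^-1` J).
Proof.
move=> hA iJ; have [g [cg Ag gf fg]] := arc_inv hA.
have -> : A `&` f @^-1` J = g @` (J `&` `[0, 1]%classic).
  apply/seteqP; split=> [x [Ax Jx]|x [t [Jt]]].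
    exists (f x); last exact: gf.
    by split => //; rewrite /= in_itv /=; exact: arc_itv hA Ax.
  rewrite /= in_itv /= => t01 <-; split; first exact: Ag.
  by rewrite /= fg.
apply: connected_continuous_connected.
  apply/connected_intervalP => s t [Js s01] [Jt t01] u sut; split.
    exact: iJ Js Jt _ sut.
  move: s01 t01; rewrite /= !in_itv /= => /andP[s0 _] /andP[_ t1].
  by case/andP: sut => su ut; rewrite (le_trans s0 su) (le_trans ut t1).
exact: continuous_subspaceW cg.
Qed.

End arcs.

Section edges.
Context {R : realType} {T : topologicalType}.
Context (cptT : compact [set: T]).
Implicit Types (A B I : set T) (f : T -> R).

Lemma homeomorphic_set0 (U V : topologicalType) (A : set U) (B : set V) :
  homeomorphic (set_type A) (set_type B) -> B !=set0 -> A !=set0.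
Proof.
move=> [_ [G _]] [y By]; exists (set_val (G (SigSub (mem_set By)))).
exact: set_valP.
Qed.

Lemma half01 : 0 < (2^-1 : R) < 1.
Proof. by rewrite invr_gt0 ltr0n invf_lt1 ?ltr1n. Qed.

(** The homeomorphisms of [I] and of its closure are given independently, so it has to be shown that
    the second one takes [I] exactly onto the open interval. *)
Lemma edge_arc I : edge R I -> exists f a b,
  is_arc (closure I) f a b /\ I = closure I `&` [set x | 0 < f x < 1].
Proof.
move=> [oI hI hcI].
have I0 : I !=set0.
  by apply: homeomorphic_set0 hI _; exists 2^-1; rewrite /= in_itv /= half01.
have cI0 : closure I !=set0 by case: I0 => x /subset_closure; exists x.
have [|f [g [cf cg fA gA [gf fg]]]] := homeomorphic_within hcI cI0.
  by exists 0; rewrite /= in_itv /= lexx ler01.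
have [|h [k [ch ck hA kA [kh hk]]]] := homeomorphic_within hI I0.
  by exists 2^-1; rewrite /= in_itv /= half01.
have sI := @subset_closure _ I.
have in01 t : 0 <= t <= 1 -> `[0, 1]%classic t by rewrite /= in_itv.
have If x y : closure I x -> closure I y -> f x = f y -> x = y.
  by move=> Ax Ay /(congr1 g); rewrite !gf.
have arcI : is_arc (closure I) f (g 0) (g 1).
  split => //; first exact: closed_closure.
    apply/seteqP; split=> [t [x Ax <-]|t t01]; first exact: fA.
    by exists (g t); [exact: gA|exact: fg].
  by split; [apply: gA|apply: gA|apply: fg|apply: fg]; apply: in01; rewrite ?lexx ?ler01.
exists f, (g 0), (g 1); split => //.
have coI : connected I.
  have -> : I = k @` `]0, 1[%classic.
    apply/seteqP; split=> [x Ix|x [t t01 <-]]; last exact: kA.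
    by exists (h x); [exact: hA|exact: kh].
  apply: connected_continuous_connected => //.
  exact/connected_intervalP/interval_is_interval.
have cofI : is_interval (f @` I).
  apply/connected_intervalP/connected_continuous_connected => //.
  exact: continuous_subspaceW cf.
(* An endpoint of the closed arc cannot lie in [I]: removing it would leave
   [I] connected, but removing a point disconnects the open interval. *)
have end_notin (J : set R) p : is_interval J -> I p ->
    (forall x, I x -> J (f x) <-> x <> p) -> False.
  move=> iJ Ip HJ.
  have cJ : connected (closure I `&` f @^-1` (J `&` f @` I)).
    apply: (arc_connected cptT arcI) => s t [Js fs] [Jt ft] u sut.
    by split; [exact: iJ Js Jt _ sut|exact: cofI fs ft _ sut].
  have E : closure I `&` f @^-1` (J `&` f @` I) = I `\ p.
    apply/seteqP; split=> [x [clx [Jx [y Iy fyx]]]|x [Ix xp]].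
      have yx : y = x by apply: If => //; exact: sI.
      by rewrite -yx; split => //; apply/(HJ _ Iy); rewrite yx.
    by split; [exact: sI|split; [exact/HJ|exists x]].
  rewrite E in cJ.
  have : is_interval (h @` (I `\ p)).
    apply/connected_intervalP/connected_continuous_connected => //.
    by apply: continuous_subspaceW ch => x [].
  have := hA p Ip; rewrite /= in_itv /= => /andP[p0 p1].
  have im t : 0 < t < 1 -> t != h p -> (h @` (I `\ p)) t.
    move=> t01 tp; have t01' : `]0, 1[%classic t by rewrite /= in_itv.
    exists (k t); last exact: hk.
    by split; [exact: kA|move=> /= kp; move: tp; rewrite -kp hk// eqxx].
  have h1 : 0 < h p / 2 < h p by rewrite divr_gt0//= ltr_pdivrMr// ltr_pMr// ltr1n.
  have h2 : h p < (h p + 1) / 2 < 1.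
    by rewrite ltr_pdivlMr// ltr_pdivrMr// mulr_natr mulr2n ltrD2l p1 mul1r ltrD2r.
  move=> /(_ (h p / 2) ((h p + 1) / 2)) /(_ _ _ (h p)) [].
  - apply: im; last by case/andP: h1 => _ /lt_eqF ->.
    by case/andP: h1 => -> /= /lt_trans; exact.
  - apply: im; last by case/andP: h2 => /gt_eqF ->.
    by case/andP: h2 => /(lt_trans p0) ->.
  - by case/andP: h1 => _ /ltW ->; case/andP: h2 => /ltW ->.
  - by move=> x [Ix xp] hxp; apply: xp; rewrite /= -(kh x Ix) -(kh p Ip) hxp.
have fI01 x : I x -> 0 < f x < 1.
  move=> Ix; have /andP[f0 f1] := arc_itv arcI (sI _ Ix).
  rewrite !lt_neqAle f0 f1 !andbT; apply/andP; split; apply/eqP => fx.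
    apply: (@end_notin `]0, +oo[%classic x _ Ix); first exact: interval_is_interval.
    move=> y Iy; rewrite /= in_itv /= andbT.
    have /andP[fy0 _] := arc_itv arcI (sI _ Iy).
    rewrite lt_neqAle fy0 andbT; split=> [/eqP ny yx|yx]; first by apply: ny; rewrite yx.
    by apply/eqP => fy; apply: yx; apply: If; [exact: sI|exact: sI|rewrite -fx].
  apply: (@end_notin `]-oo, 1[%classic x _ Ix); first exact: interval_is_interval.
  move=> y Iy; rewrite /= in_itv /=.
  have /andP[_ fy0] := arc_itv arcI (sI _ Iy).
  rewrite lt_neqAle fy0 andbT; split=> [/eqP ny yx|yx]; first by apply: ny; rewrite yx.
  by apply/eqP => fy; apply: yx; apply: If; [exact: sI|exact: sI|rewrite fx].
apply/seteqP; split=> [x Ix|x [clx /andP[fx0 fx1]]].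
  by split; [exact: sI|exact: fI01].
have [cA cf' _ _ [Aa Ab fa fb]] := arcI.
have cl (C : set R) : closed C -> (forall y, I y -> C (f y)) ->
    forall y, closure I y -> C (f y).
  move=> cC HC y cly; have cC' : closed (closure I `&` f @^-1` C).
    by move/within_closedP : cf; apply.
  have : closure I `<=` closure I `&` f @^-1` C.
    rewrite [X in _ `<=` X](closure_id _).1//; apply: closureS => z Iz.
    by split; [exact: sI|exact: HC].
  by move=> /(_ y cly)[].
have [y1 Iy1 fy1] : exists2 y, I y & f x <= f y.
  apply: contrapT => H; suff : 1 <= f x by rewrite leNgt fx1.
  rewrite -fb; apply: (cl [set t | t <= f x] (@closed_le _ _) _ _ Ab) => y Iy /=.
  by rewrite leNgt; apply/negP => xy; apply: H; exists y => //; exact: ltW.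
have [y2 Iy2 fy2] : exists2 y, I y & f y <= f x.
  apply: contrapT => H; suff : f x <= 0 by rewrite leNgt fx0.
  rewrite -fa; apply: (cl [set t | f x <= t] (@closed_ge _ _) _ _ Aa) => y Iy /=.
  by rewrite leNgt; apply/negP => xy; apply: H; exists y => //; exact: ltW.
have [|||y Iy fyx] := cofI (f y2) (f y1) _ _ (f x).
- by exists y2.
- by exists y1.
- by rewrite fy1 fy2.
by have <- : y = x by apply: If => //; exact: sI.
Qed.

Lemma edge_bnd I f a b : is_arc (closure I) f a b ->
  I = closure I `&` [set x | 0 < f x < 1] ->
  closure I = I `|` [set a; b] /\ [/\ ~ I a, ~ I b & a <> b].
Proof.
move=> hA IE; have [_ _ If _ [Aa Ab fa fb]] := hA; split; last first.
  by rewrite IE; split=> [[_]|[_]|];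
    rewrite /= ?fa ?fb ?ltxx ?andbF//; exact: arc_neq hA.
apply/seteqP; split=> x; last first.
  by case=> [|[->|->]] //; exact: subset_closure.
move=> clx; have /andP[f0 f1] := arc_itv hA clx.
have [fx0|fx0] := eqVneq (f x) 0.
  by right; left; apply: If; rewrite // fa.
have [fx1|fx1] := eqVneq (f x) 1.
  by right; right; apply: If; rewrite // fb.
by left; rewrite IE; split => //=; rewrite !lt_neqAle f0 f1 fx1 eq_sym fx0.
Qed.

Lemma edge_edge_like I : edge R I -> edge_like I.
Proof.
move=> eI; have [oI _ _] := eI; have [f [a [b [hA IE]]]] := edge_arc eI.
split => //.
- have -> : I = closure I `&` f @^-1` `]0, 1[%classic.
    rewrite {1}IE; apply/seteqP; split=> x [clx] /=; first by rewrite in_itv.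
    by rewrite /= in_itv.
  exact: (arc_connected cptT hA) (@interval_is_interval _ _).
- have [x clx fx] := arc_preimage hA (t := 2^-1) ltac:(by case/andP: half01 => /ltW -> /ltW ->).
  by exists x; rewrite IE; split => //=; rewrite fx half01.
- by exists a, b; exact: edge_bnd IE.
Qed.

End edges.

(** * Weighted sums of functions *)

Section weighted_sum.
Context {R : realType} {T : topologicalType}.
Implicit Types (A : set T).

Lemma weighted_sum (A : set T) (g : nat -> T -> R) :
  (forall n, {within A, continuous (g n)}) ->
  (forall n x, A x -> 0 <= g n x <= 1) ->
  exists f : T -> R, [/\ {within A, continuous f},
    forall x y, A x -> A y -> (forall n, g n x <= g n y) -> f x <= f y &
    forall x y, A x -> A y -> (forall n, g n x <= g n y) ->
      (exists n, g n x < g n y) -> f x < f y].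
Proof.
move=> cg g01.
pose F N x := \sum_(n < N) 2^-1 ^+ n.+1 * g n x.
have FS N x : F N.+1 x = F N x + 2^-1 ^+ N.+1 * g N x.
  by rewrite /F big_ord_recr.
have h0 n : 0 < (2^-1 : R) ^+ n by rewrite exprn_gt0// invr_gt0 ltr0n.
have hS n : (2^-1 : R) ^+ n = 2^-1 ^+ n.+1 + 2^-1 ^+ n.+1.
  by rewrite exprS -mulrDl (_ : 2^-1 + 2^-1 = 1) ?mul1r// [RHS]splitr mul1r.
have Finc x : A x -> nondecreasing_seq (F ^~ x).
  move=> Ax; apply/nondecreasing_seqP => n; rewrite FS lerDl.
  by rewrite mulr_ge0 ?(ltW (h0 _))//; have /andP[] := g01 n x Ax.
(* The weights after index [n] add up to [2^-1 ^+ n]. This gives an upper bound for all later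
   partial sums, and with it uniform convergence. *)
have Fdec x : A x -> nonincreasing_seq (fun n => F n x + 2^-1 ^+ n).
  move=> Ax; apply/nonincreasing_seqP => n; rewrite FS (hS n) -addrA lerD2l.
  by rewrite lerD2r ler_piMr ?(ltW (h0 _))//; have /andP[] := g01 n x Ax.
have Fbnd x n m : A x -> F n x <= F m x + 2^-1 ^+ m.
  move=> Ax; have [nm|mn] := leqP n m.
    by rewrite (le_trans (Finc x Ax _ _ nm))// lerDl ltW.
  rewrite (le_trans _ (Fdec x Ax _ _ (ltnW mn)))// lerDl; exact: ltW.
pose f x := limn (F ^~ x).
have Fcvg x : A x -> cvgn (F ^~ x).
  move=> Ax; apply: nondecreasing_is_cvgn; first exact: Finc.
  by exists (F 0 x + 2^-1 ^+ 0) => _ [n _ <-]; exact: Fbnd.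
have Fle x n : A x -> F n x <= f x.
  by move=> Ax; apply: nondecreasing_cvgn_le; [exact: Finc|exact: Fcvg].
have lef x c m : A x -> (forall n, (m <= n)%N -> F n x <= c) -> f x <= c.
  move=> Ax H; apply: limr_le; first exact: Fcvg.
  by exists m => // n /=; exact: H.
exists f; split.
- apply: (@uniform_limit_continuous_subspace _ _ A (F @ \oo)).
    near_simpl; apply: nearW; elim=> [|N IH].
      rewrite (_ : F 0 = cst 0); first by move=> x; exact: cvg_cst.
      by apply/funext => x; rewrite /F big_ord0.
    rewrite (_ : F N.+1 = (fun x => F N x + 2^-1 ^+ N.+1 * g N x)); last first.
      by apply/funext => x; exact: FS.
    move=> x; apply: cvgD; first exact: IH.
    by apply: cvgM; [exact: cvg_cst|exact: cg].
  move=> P /uniform_nbhs[E [entE EP]].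
  move: entE; rewrite -entourage_ballE => -[e /= e0 eE].
  have := near_infty_natSinv_expn_lt (PosNum e0).
  apply: filterS => n /= ne; apply: EP => y Ay; apply: eE => /=.
  rewrite /ball/= distrC ler0_norm ?subr_le0 ?Fle// opprB.
  apply: le_lt_trans ne; rewrite lerBlDl div1r -exprVn.
  by apply: (lef y _ 0 Ay) => m _; exact: Fbnd.
- move=> x y Ax Ay xy; apply: (lef x _ 0 Ax) => n _.
  apply: le_trans (Fle y n Ay); rewrite /F; apply: ler_sum => i _.
  by rewrite ler_wpM2l// ltW.
- move=> x y Ax Ay xy [m gm].
  (* The gain from the single index [m]; it survives in every later partial sum, hence in the
     limit. *)
  pose c := 2^-1 ^+ m.+1 * (g m y - g m x).
  have c0 : 0 < c by rewrite mulr_gt0// subr_gt0.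
  suff : f x <= f y - c by move=> /le_lt_trans; apply; rewrite gtrBl.
  apply: (lef x _ m.+1 Ax) => n mn; rewrite lerBrDr.
  apply: le_trans (Fle y n Ay).
  rewrite -lerBrDl -sumrB (bigD1 (Ordinal mn))//= -mulrBr lerDl sumr_ge0// => i _.
  by rewrite -mulrBr mulr_ge0// ?subr_ge0// ltW.
Qed.

End weighted_sum.

(** * Irreducible subcontinua are arcs *)

Section crossings.
Context {R : realType} {T : topologicalType}.
Context (cptT : compact [set: T]).
Implicit Types (A e P Q : set T) (f phi : T -> R).

Lemma closure_disjoint (e O : set T) : open O -> e `&` O = set0 ->
  closure e `&` O = set0.
Proof.
move=> oO eO; rewrite -subset0 => x [clx Ox].
by have [|y []] := clx O; [exact: open_nbhs_nbhs|move=> ey Oy; at_point y].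
Qed.

(* [P] and [Q] are the two sides of the edge [e] in [A], and [phi] measures the
   progress of a point of [A] from [P] to [Q] across [e]. *)
Definition crossing A (s t : T) e P Q (u v : T) phi :=
  [/\ [/\ closed P, connected P & P s], [/\ closed Q, connected Q & Q t],
      [/\ P `&` Q = set0, A `\` e = P `|` Q & closure e `<=` A],
      P `&` closure e = [set u] /\ Q `&` closure e = [set v] &
      [/\ {within A, continuous phi}, forall x, P x -> phi x = 0,
          forall x, Q x -> phi x = 1, forall x, e x -> 0 < phi x < 1 &
          forall x y, e x -> e y -> phi x = phi y -> x = y]].

Lemma crossing_exists A s t e f a b P Q : is_arc (closure e) f a b ->
  e = closure e `&` [set x | 0 < f x < 1] -> closed A -> connected A ->
  closed P -> connected P -> closed Q -> connected Q ->
  P `&` Q = set0 -> A `\` e = P `|` Q -> P s -> Q t -> P a -> Q b ->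
  exists phi, crossing A s t e P Q a b phi.
Proof.
move=> hA eE cA coA cP coP cQ coQ PQ AE Ps Qt Pa Qb.
have [ce cf If fA [ea eb fa fb]] := hA.
have [bE [na nb ab]] := edge_bnd hA eE.
have se := @subset_closure _ e.
have PA : P `<=` A by move=> x Px; have : (A `\` e) x by [rewrite AE; left]; case.
have QA : Q `<=` A by move=> x Px; have : (A `\` e) x by [rewrite AE; right]; case.
have Pe : P `&` closure e = [set a].
  apply/seteqP; split=> [x [Px]|_ ->//]; rewrite bE => -[ex|[//|xb]].
    by have : (A `\` e) x by [rewrite AE; left]; case.
  by rewrite xb in Px; at_point b.
have Qe : Q `&` closure e = [set b].
  apply/seteqP; split=> [x [Px]|_ ->//]; rewrite bE => -[ex|[xb|//]].
    by have : (A `\` e) x by [rewrite AE; right]; case.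
  by rewrite xb in Px; at_point a.
(* If [A] missed a point [z] of [e], then [P] with the points of [e] below level [f z] and [Q] with
   those above would separate [A]. *)
have eA : e `<=` A.
  move=> z ez; apply: contrapT => nAz.
  have [_ /andP[fz0 fz1]] : (closure e `&` [set x | 0 < f x < 1]) z by rewrite -eE.
  have cl C : closed C -> closed (A `&` (closure e `&` f @^-1` C)).
    by move=> cC; apply: closedI => //; move/within_closedP : cf; apply.
  have c1 := cl _ (@closed_le _ (f z)); have c2 := cl _ (@closed_ge _ (f z)).
  have [|||] := connected_closedU coA (closedU cP c1) (closedU cQ c2).
  - move=> x Ax; have [ex|nex] := pselect (e x).
      have [xz|zx] := leP (f x) (f z).
        by left; right; split=> //; split => //; exact: se.
      by right; right; split=> //; split => //; [exact: se|exact: ltW].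
    by have : (P `|` Q) x; [rewrite -AE|case; [left|right]; left].
  - apply/seteqP; split=> // x [Ax [[Px|[_ [ex /= xz]]] [Qx|[_ [ex' /= zx]]]]].
    + by at_point x.
    + have : (P `&` closure e) x by []; rewrite Pe => xa.
      by move: zx; rewrite xa fa leNgt fz0.
    + have : (Q `&` closure e) x by []; rewrite Qe => xb.
      by move: xz; rewrite xb fb leNgt fz1.
    + apply: nAz; rewrite (_ : z = x) //; apply: If => //; first exact: se.
      by apply/eqP; rewrite eq_le zx xz.
  - move=> /(_ t (QA _ Qt))[Pt|[_ [et /= tz]]]; first by at_point t.
    have : (Q `&` closure e) t by []; rewrite Qe => tb.
    by move: tz; rewrite tb fb leNgt fz1.
  - move=> /(_ s (PA _ Ps))[Pt|[_ [et /= tz]]]; first by at_point s.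
    have : (P `&` closure e) s by []; rewrite Pe => tb.
    by move: tz; rewrite tb fa leNgt fz0.
pose phi x := if pselect (P x) then 0 else if pselect (Q x) then 1 else f x.
have phiP x : P x -> phi x = 0 by rewrite /phi; case: (pselect (P x)).
have phiQ x : Q x -> phi x = 1.
  move=> Qx; rewrite /phi; case: (pselect (P x)) => [Px|nPx] /=.
    by have : (P `&` Q) x by []; rewrite PQ.
  by case: (pselect (Q x)).
have phie x : closure e x -> phi x = f x.
  move=> ex; rewrite /phi; case: (pselect (P x)) => [Px|nPx] /=.
    by have : (P `&` closure e) x by []; rewrite Pe => ->; rewrite fa.
  case: (pselect (Q x)) => [Qx|//] /=.
  by have : (Q `&` closure e) x by []; rewrite Qe => ->; rewrite fb.
have ef x : e x -> 0 < f x < 1.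
  by rewrite eE => -[].
exists phi; split=> //.
- split => //.
  by rewrite [A](closure_id _).1//; exact: closureS.
- split => //.
  + have -> : A = (P `|` Q) `|` closure e.
      apply/seteqP; split => x.
        move=> Ax; have [ex|nex] := pselect (e x); first by right; exact: se.
        by left; rewrite -AE.
      case=> [|ex]; first by rewrite -AE => -[].
      by move: ex; rewrite bE => -[/eA//|[->|->]]; [exact: PA|exact: QA].
    have w0 : {within P, continuous phi}.
      apply: (@subspace_eq_continuous _ _ _ (cst 0)) => [x /set_mem/phiP/esym//|x].
      exact: cvg_cst.
    have w1 : {within Q, continuous phi}.
      apply: (@subspace_eq_continuous _ _ _ (cst (1 : R))) => [x /set_mem/phiQ/esym//|x].
      exact: cvg_cst.
    have we : {within closure e, continuous phi}.
      by apply: (@subspace_eq_continuous _ _ _ f); first by move=> x /set_mem/phie/esym.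
    apply: withinU_continuous => //; first exact: closedU.
    exact: withinU_continuous.
  + by move=> x ex; rewrite phie; [exact: ef|exact: se].
  + by move=> x y ex ey; rewrite !phie; do ?exact: se; apply: If; exact: se.
Qed.

Lemma crossing_cases A s t e P Q u v phi x : crossing A s t e P Q u v phi ->
  A x -> [\/ P x, Q x | e x].
Proof.
case=> _ _ [_ AE _] _ _ Ax; have [ex|nex] := pselect (e x); first exact: Or33.
have : (P `|` Q) x by rewrite -AE.
by case; [exact: Or31|exact: Or32].
Qed.

Lemma crossing_itv A s t e P Q u v phi x : crossing A s t e P Q u v phi ->
  A x -> 0 <= phi x <= 1.
Proof.
move=> H /(crossing_cases H); have [_ _ _ _ [_ phiP phiQ phie _]] := H.
move=> [/phiP->|/phiQ->|/phie/andP[h1 h2]]; rewrite ?lexx ?ler01//.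
by rewrite !ltW.
Qed.

(** Being connected and disjoint from [e], the edge [e'] lies in [P] or in [Q]. If it lies in [P],
    then [Q] with the closure of [e] is connected, avoids [e'] and contains [t], so [phi'] is 1
    there; and [y] is there because [phi y] is positive. If it lies in [Q], then in the same way
    [phi' x] is 0. *)
Lemma crossing_chain A s t e P Q u v phi e' P' Q' u' v' phi' x y :
  crossing A s t e P Q u v phi -> crossing A s t e' P' Q' u' v' phi' ->
  connected e -> connected e' -> open e' -> e `&` e' = set0 ->
  A x -> A y -> phi x < phi y -> phi' x <= phi' y.
Proof.
move=> H H' ce ce' oe' ee' Ax Ay xy.
have /andP[x0 x1] := crossing_itv H Ax; have /andP[y0 y1] := crossing_itv H Ay.
have /andP[x0' x1'] := crossing_itv H' Ax; have /andP[y0' y1'] := crossing_itv H' Ay.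
have [[cP coP Ps] [cQ coQ Qt] [PQ AE eA] [Pu Qv] [_ phiP phiQ _ _]] := H.
have [[cP' _ Ps'] [cQ' _ Qt'] [PQ' AE' eA'] _ [_ phiP' phiQ' _ _]] := H'.
have se := @subset_closure _ e; have se' := @subset_closure _ e'.
have ce'0 := closure_disjoint oe' ee'.
have cce := connected_closure ce.
have side Z : connected Z -> Z `<=` A -> Z `&` e' = set0 -> Z `<=` P' \/ Z `<=` Q'.
  move=> cZ ZA Ze; apply: connected_closedU => //.
    by move=> z; at_point z.
  by rewrite PQ' setI0.
have [||e'P|e'Q] := connected_closedU ce' cP cQ.
- by clear AE'; move=> z; at_point z.
- by rewrite PQ setI0.
- have [|||QP|QQ] := side (Q `|` closure e).
  + apply: connectedU => //; exists v; have : (Q `&` closure e) v by rewrite Qv.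
    by [].
  + by clear AE'; move=> z; at_point z.
  + by clear AE'; apply/seteqP; split=> z; at_point z.
  + by have := QP t (or_introl Qt); move=> P't; have : (P' `&` Q') t by []; rewrite PQ'.
  + have -> : phi' y = 1 by apply: phiQ'; apply: QQ; case: (crossing_cases H Ay) => [Py|Qy|ey];
      [move: xy; rewrite (phiP _ Py) ltNge x0|left|right; exact: se].
    by [].
- have [|||PP|PQ1] := side (P `|` closure e).
  + apply: connectedU => //; exists u; have : (P `&` closure e) u by rewrite Pu.
    by [].
  + by clear AE'; move=> z; at_point z.
  + by clear AE'; apply/seteqP; split=> z; at_point z.
  + have -> : phi' x = 0 by apply: phiP'; apply: PP; case: (crossing_cases H Ax) => [Px|Qx|ex];
      [left|move: xy; rewrite (phiQ _ Qx) ltNge y1|right; exact: se].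
    by [].
  + by have := PQ1 s (or_introl Ps); move=> Q's; have : (P' `&` Q') s by []; rewrite PQ'.
Qed.

Definition irreducible_between A (s t : T) := [/\ closed A, connected A, A s, A t &
  forall B, B `<=` A -> closed B -> connected B -> B s -> B t -> B = A].

(** By irreducibility no piece of [A] without [e] can contain both [s] and [t], so there are two
    pieces with one of the points in each. *)
Lemma crossing_edge A s t e : irreducible_between A s t -> edge R e ->
  ~ e s -> ~ e t -> e `&` A !=set0 ->
  exists P Q u v phi, crossing A s t e P Q u v phi.
Proof.
move=> [cA coA As At irr] he ns nt [p [ep Ap]].
have [f [a [b [hA eE]]]] := edge_arc cptT he.
have oe : open e by case: he.
have [bE [na nb ab]] := edge_bnd hA eE.
have ebnd : closure e `\` e `<=` [set a; b] by rewrite bE => z [[]].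
have AE0 : A `\` e !=set0 by exists s.
have irr' B : B `<=` A `\` e -> closed B -> connected B -> B s -> B t -> False.
  move=> BA cB coB Bs Bt; have BE : B = A.
    by apply: irr => // z /BA[].
  by have [_] : (A `\` e) p by apply: BA; rewrite BE.
have [cAe|[K [L [[cK coK] [cL coL] KL AE [Ka Lb]]]]] := connected_cut cA coA oe ebnd AE0.
  exfalso; apply: (irr' (A `\` e)) => //.
  by apply: closedI => //; exact: open_closedC.
have KA : K `<=` A `\` e by rewrite AE; exact: subsetUl.
have LA : L `<=` A `\` e by rewrite AE; exact: subsetUr.
have : (A `\` e) s by []; have : (A `\` e) t by [].
rewrite {1 2}AE => -[Kt|Lt] [Ks|Ls].
- by case: (irr' K).
(* Here [s] lies on the side of [b]; the coordinate is reversed so that the crossing runs from [s]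
   to [t]. *)
- have eE' : e = closure e `&` [set x | 0 < 1 - f x < 1].
    rewrite {1}eE; apply/seteqP; split=> z [ez /=].
      by rewrite subr_gt0 gtrBl andbC.
    by rewrite subr_gt0 gtrBl andbC.
  have [||phi H] := crossing_exists (arc_rev hA) eE' cA coA cL coL cK coK _ _ Ls Kt Lb Ka.
  + by rewrite setIC.
  + by rewrite setUC.
  + by exists L, K, b, a, phi.
- have [||phi H] := crossing_exists hA eE cA coA cK coK cL coL _ _ Ks Lt Ka Lb => //.
  by exists K, L, a, b, phi.
- by case: (irr' L).
Qed.

End crossings.

Section irreducible_continua.
Context {R : realType} {T : topologicalType}.
Context (cptT : compact [set: T]) (hT : hausdorff_space T).
Implicit Types (A e P Q : set T) (f phi : T -> R).

(** Induction on the removed edges: an edge whose map does not distinguish [x] from [y] can be put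
    back without losing the separation. If all could be put back, the connected set [A] itself would
    be separated. *)
Lemma crossing_separates (E : set (set T)) A s t (phi : set T -> T -> R) x y E' :
  connected A ->
  (forall e, E e -> e `&` A !=set0 ->
    exists P Q u v, crossing A s t e P Q u v (phi e)) ->
  A x -> A y -> (forall e, E e -> ~ e x /\ ~ e y) ->
  finite_set E' -> E' `<=` E -> forall K L, closed K -> closed L ->
  K `&` L = set0 -> A `\` \bigcup_(e in E') e `<=` K `|` L -> K x -> L y ->
  exists e, [/\ E e, e `&` A !=set0 & phi e x <> phi e y].
Proof.
move=> coA hphi Ax Ay nE fE'; elim/finite_set_ind : E' / fE' => [|e E' _ nE'e IH] E'E.
  rewrite bigcup_set0 setD0 => K L cK cL KL AKL Kx Ly; exfalso.
  have [|AK|AL] := connected_closedU coA cK cL AKL.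
  - by rewrite KL setI0.
  - by have := AK y Ay; at_point y.
  - by have := AL x Ax; at_point x.
have Ee : E e by apply: E'E; left.
have {}IH := IH (fun z h => E'E z (or_intror h)).
rewrite bigcup_setU bigcup_set1 => K L cK cL KL AKL Kx Ly.
have [eA|eA] := pselect (e `&` A !=set0); last first.
  apply: (IH K L) => // z [Az nz]; apply: AKL; split => // -[ez|//].
  by apply: eA; exists z.
have [xy|] := pselect (phi e x = phi e y); last by exists e.
have [P [Q [u [v H]]]] := hphi e Ee eA.
(* Both points lie in [M], and the rest [N] of [A] touches [M] only at [w]:
   putting all of [N] on the side of [w] makes [e] superfluous. *)
have step M N (w : T) : closed M -> closed N -> A `<=` M `|` N -> M `<=` A ->
    M `&` N `<=` [set w] -> M `&` e = set0 -> M x -> M y ->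
    exists e, [/\ E e, e `&` A !=set0 & phi e x <> phi e y].
  move=> cM cN AMN MA MNw Me Mx My.
  have MKL : M `\` \bigcup_(i in E') i `<=` K `|` L.
    by move=> z; at_point z.
  have [Kw|nKw] := pselect (K w).
    have LMN : L `&` (M `&` N) = set0.
      by rewrite -subset0 => z [Lz /MNw zw]; rewrite zw in Lz; at_point w.
    apply: (IH ((K `&` M) `|` N) (L `&` M)) => //.
    + by apply: closedU => //; exact: closedI.
    + exact: closedI.
    + by apply/seteqP; split=> z; at_point z.
    + by move=> z; at_point z.
    + by left.
  have KMN : K `&` (M `&` N) = set0.
    by rewrite -subset0 => z [Lz /MNw zw]; rewrite zw in Lz; at_point w.
  apply: (IH (K `&` M) ((L `&` M) `|` N)) => //.
  + exact: closedI.
  + by apply: closedU => //; exact: closedI.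
  + by apply/seteqP; split=> z; at_point z.
  + by move=> z; at_point z.
  + by left.
have [[cP coP Ps] [cQ coQ Qt] [PQ AE eA'] [Pu Qv] [_ phiP phiQ _ _]] := H.
have se := @subset_closure _ e.
have [nex ney] := nE e Ee.
have PA : P `<=` A by move=> z; have := congr1 (@^~ z) AE; at_point z.
have QA : Q `<=` A by move=> z; at_point z.
have ce : closed (closure e) by exact: closed_closure.
have Pe : P `&` e = set0 by apply/seteqP; split => z; at_point z.
have Qe : Q `&` e = set0 by apply/seteqP; split => z; at_point z.
case: (crossing_cases H Ax) => [Px|Qx|//]; case: (crossing_cases H Ay) => [Py|Qy|//].
- apply: (step P (Q `|` closure e) u) => //; first exact: closedU.
    by move=> z; at_point z.
  by rewrite setIUr PQ set0U Pu.
- by move: xy; rewrite (phiP x)// (phiQ y)// => /esym/eqP; rewrite oner_eq0.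
- by move: xy; rewrite (phiQ x)// (phiP y)// => /eqP; rewrite oner_eq0.
- apply: (step Q (P `|` closure e) v) => //; first exact: closedU.
    by move=> z; at_point z.
  by rewrite setIUr setIC PQ set0U Qv.
Qed.

Lemma irreducible_arc (E : set (set T)) (En : nat -> set (set T)) A s t :
  edge_set R E -> totally_disconnected ([set: T] `\` \bigcup_(e in E) e) ->
  (forall n, finite_set (En n)) -> (forall n, En n `<=` E) ->
  (forall e, E e -> exists n, En n e) ->
  irreducible_between A s t -> (forall e, E e -> ~ e s /\ ~ e t) -> s <> t ->
  (exists f : T -> R, is_arc A f s t) /\
  forall e, E e -> e `&` A !=set0 -> closure e `<=` A.
Proof.
move=> [eE tE] tV fEn EnE hEn hA nst st; have [cA coA As At irr] := hA.
have ex e : E e -> e `&` A !=set0 ->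
    exists P Q u v phi, crossing A s t e P Q u v phi.
  move=> Ee eA; have [ns nt] := nst _ Ee.
  exact: crossing_edge (eE _ Ee) ns nt eA.
split; last first.
  by move=> e Ee /(ex _ Ee)[P [Q [u [v [phi [_ _ []]]]]]].
(* Edges that miss [A] get the zero map, so that the bounds and the monotonicity below hold for
   every [e]. *)
have /choice[phi hphi] : forall e, exists p : T -> R,
    (E e -> e `&` A !=set0 -> exists P Q u v, crossing A s t e P Q u v p) /\
    (~ (E e /\ e `&` A !=set0) -> p = cst 0).
  move=> e.
  have [[Ee eA]|nEe] := pselect (E e /\ e `&` A !=set0).
    have [P [Q [u [v [p Hp]]]]] := ex e Ee eA; exists p; split; last by case.
    by move=> _ _; exists P, Q, u, v.
  by exists (cst 0); split=> // Ee eA; case: nEe.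
have cphi e : {within A, continuous (phi e)}.
  have [[Ee eA]|nEe] := pselect (E e /\ e `&` A !=set0).
    by have [/(_ Ee eA)[P [Q [u [v [_ _ _ _ []]]]]]] := hphi e.
  by have [_ /(_ nEe) ->] := hphi e; move=> x; exact: cvg_cst.
have phi01 e x : A x -> 0 <= phi e x <= 1.
  move=> Ax; have [[Ee eA]|nEe] := pselect (E e /\ e `&` A !=set0).
    by have [/(_ Ee eA)[P [Q [u [v H]]]] _] := hphi e; exact: crossing_itv H Ax.
  by have [_ /(_ nEe) ->] := hphi e; rewrite /= lexx ler01.
have phist e x : A x -> phi e s <= phi e x <= phi e t.
  move=> Ax; have [[Ee eA]|nEe] := pselect (E e /\ e `&` A !=set0).
    have [/(_ Ee eA)[P [Q [u [v H]]]] _] := hphi e.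
    have [[_ _ Ps] [_ _ Qt] _ _ [_ phiP phiQ _ _]] := H.
    by rewrite (phiP s)// (phiQ t)//; exact: phi01.
  by have [_ /(_ nEe) ->] := hphi e; rewrite /= lexx.
have chain e e' x y : A x -> A y -> phi e x < phi e y -> phi e' x <= phi e' y.
  move=> Ax Ay xy; have [<-|ee'] := eqVneq e e'; first exact: ltW.
  have [[Ee eA]|nEe] := pselect (E e /\ e `&` A !=set0); last first.
    by move: xy; have [_ /(_ nEe) ->] := hphi e; rewrite ltxx.
  have [[Ee' eA']|nEe] := pselect (E e' /\ e' `&` A !=set0); last first.
    by have [_ /(_ nEe) ->] := hphi e'.
  have [/(_ Ee eA)[P [Q [u [v H]]]] _] := hphi e.
  have [/(_ Ee' eA')[P' [Q' [u' [v' H']]]] _] := hphi e'.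
  have [oe ce _ _] := edge_edge_like cptT (eE _ Ee).
  have [oe' ce' _ _] := edge_edge_like cptT (eE _ Ee').
  apply: (crossing_chain H H') => //.
  apply/eqP; apply: contraNT ee' => /set0P ee'; apply/eqP.
  exact: tE.
have phi_sep x y : A x -> A y -> x <> y -> exists2 e, E e & phi e x <> phi e y.
  move=> Ax Ay xy.
  (* A point inside an edge is distinguished from all others by the map of that edge. Two points
     outside all edges need [edges_separation]. *)
  have inE z w : A z -> A w -> z <> w -> (exists2 e, E e & e z) ->
      exists2 e, E e & phi e z <> phi e w.
    move=> Az Aw zw [e Ee ez]; exists e => //.
    have eA : e `&` A !=set0 by exists z.
    have [/(_ Ee eA)[P [Q [u [v H]]]] _] := hphi e.
    have [_ _ _ _ [_ phiP phiQ phie phi_inj]] := H.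
    have /andP[z0 z1] := phie _ ez.
    case: (crossing_cases H Aw) => [/phiP->|/phiQ->|ew].
    - by move=> pz; move: z0; rewrite pz ltxx.
    - by move=> pz; move: z1; rewrite pz ltxx.
    - by move=> pzw; apply: zw; exact: phi_inj.
  have [xE|nxE] := pselect (exists2 e, E e & e x); first exact: inE.
  have [yE|nyE] := pselect (exists2 e, E e & e y).
    by have [|e Ee exy] := inE y x Ay Ax _ yE; [exact/nesym|exists e => //; exact/nesym].
  have oE e : E e -> open e by move=> /eE[].
  have [|||E' [K [L [[fE' E'E] cK cL KL [TE' Kx Ly]]]]] := @edges_separation _ cptT hT E x y oE tV.
  - by split => // -[e Ee ex']; apply: nxE; exists e.
  - by split => // -[e Ee ex']; apply: nyE; exists e.
  - by [].
  have [|||e [Ee _ exy]] := @crossing_separates E A s t phi x y E' coA _ Ax Ay _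
    fE' E'E K L cK cL KL _ Kx Ly.
  - by move=> e Ee; have [h _] := hphi e; exact: h.
  - by move=> e Ee; split=> ez; [apply: nxE|apply: nyE]; exists e.
  - by rewrite -TE' => z [Az]; split.
  - by exists e.
have /choice[sn snE] : forall n, exists q : seq (set T), En n = [set` q].
  by move=> n; have /finite_seqP := fEn n.
(* The edges come in finite batches [En n], so the sequence to be summed consists of sums over
   batches. Division by the size plus one keeps the values in [[0, 1]] and also allows an empty
   batch. *)
pose g n x := (\sum_(e <- sn n) phi e x) / (size (sn n)).+1%:R.
have k0 n : 0 < ((size (sn n)).+1%:R : R)^-1 by rewrite invr_gt0 ltr0n.
have gle x y : A x -> A y -> (forall e, E e -> phi e x <= phi e y) ->
    forall n, g n x <= g n y.
  move=> Ax Ay xy n; rewrite /g ler_wpM2r ?(ltW (k0 n))// big_seq [leRHS]big_seq.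
  apply: ler_sum => e en; apply: xy; apply: (EnE n); by rewrite snE.
have glt x y : A x -> A y -> (forall e, E e -> phi e x <= phi e y) ->
    (exists2 e, E e & phi e x < phi e y) -> exists n, g n x < g n y.
  move=> Ax Ay xy [e Ee exy]; have [n ne] := hEn e Ee; exists n.
  rewrite /g ltr_pM2r// big_seq [ltRHS]big_seq.
  have en : e \in sn n by rewrite snE in ne.
  rewrite -!big_seq (big_rem e)//= [ltRHS](big_rem e)//=.
  apply: ltr_leD => //; rewrite big_seq [leRHS]big_seq.
  by apply: ler_sum => e' /mem_rem e'n; apply: xy; apply: (EnE n); rewrite snE.
have [f [cf fle flt]] : exists f : T -> R, [/\ {within A, continuous f},
    forall x y, A x -> A y -> (forall n, g n x <= g n y) -> f x <= f y &
    forall x y, A x -> A y -> (forall n, g n x <= g n y) ->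
      (exists n, g n x < g n y) -> f x < f y].
  apply: weighted_sum => [n|n x Ax].
    have cs (q : seq (set T)) : {within A, continuous (fun x => \sum_(e <- q) phi e x)}.
      elim: q => [|e q IH].
        under eq_fun do rewrite big_nil.
        by move=> x; exact: cvg_cst.
      under eq_fun do rewrite big_cons.
      by move=> x; apply: cvgD; [exact: cphi|exact: IH].
    by move=> x; apply: cvgM; [exact: cs|exact: cvg_cst].
  rewrite /g; apply/andP; split.
    rewrite mulr_ge0 ?(ltW (k0 n))// sumr_ge0// => e _.
    by have /andP[] := phi01 e x Ax.
  rewrite ler_pdivrMr ?ltr0n// mul1r.
  apply: (@le_trans _ _ (\sum_(e <- sn n) 1)).
    by apply: ler_sum => e _; have /andP[] := phi01 e x Ax.
  by rewrite big_const_seq count_predT iter_addr_0 ler_nat.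
have finj x y : A x -> A y -> x <> y -> f x <> f y.
  move=> Ax Ay xy; have [e Ee /eqP] := phi_sep x y Ax Ay xy.
  rewrite neq_lt => /orP[exy|eyx] fxy.
    have : f x < f y.
      by apply: flt => //; [apply: gle => // e' _; exact: chain exy|
        apply: glt => //; [move=> e' _; exact: chain exy|exists e]].
    by rewrite fxy ltxx.
  have : f y < f x.
    by apply: flt => //; [apply: gle => // e' _; exact: chain eyx|
      apply: glt => //; [move=> e' _; exact: chain eyx|exists e]].
  by rewrite fxy ltxx.
have fs x : A x -> f s <= f x.
  by move=> Ax; apply: fle => //; apply: gle => // e _; have /andP[] := phist e x Ax.
have ft x : A x -> f x <= f t.
  by move=> Ax; apply: fle => //; apply: gle => // e _; have /andP[] := phist e x Ax.
have fst : f s < f t.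
  by rewrite lt_neqAle fs// andbT; apply/eqP; exact: finj.
have fA : f @` A = `[f s, f t]%classic.
  apply/seteqP; split=> [_ [x Ax <-]|r]; rewrite /= in_itv /=; first by rewrite fs// ft.
  move=> r01; have : is_interval (f @` A).
    exact/connected_intervalP/connected_continuous_connected.
  by apply; [exists s|exists t|].
exists (fun x => (f x - f s) / (f t - f s)).
have d0 : 0 < f t - f s by rewrite subr_gt0.
have dn0 : f t - f s != 0 by rewrite gt_eqF.
split => //.
- move=> x; apply: cvgM; last exact: cvg_cst.
  by apply: cvgB; [exact: cf|exact: cvg_cst].
- move=> x y Ax Ay /(congr1 (fun r => r * (f t - f s))).
  rewrite !mulfVK// => /addIr fxy; apply: contrapT => xy.
  exact: (finj x y).
- apply/seteqP; split=> r.
    move=> [x Ax <-]; rewrite /= in_itv /= divr_ge0 ?subr_ge0 ?fs//=.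
    by rewrite ler_pdivrMr// mul1r lerD2r ft.
  rewrite /= in_itv /= => /andP[r0 r1].
  have : (f @` A) (f s + r * (f t - f s)).
    rewrite fA /= in_itv /= lerDl mulr_ge0 ?(ltW d0)//=.
    by rewrite -lerBrDl -[leRHS]mul1r ler_wpM2r// ltW.
  by case=> x Ax fx; exists x => //; rewrite fx addrC addKr mulfK.
- by split => //; [rewrite subrr mul0r|rewrite divff].
Qed.

End irreducible_continua.

(** * Finite graphs *)

Section finite_graphs.
Context {R : realType} {T : topologicalType}.
Implicit Types (A Y : set T) (f : T -> R).

(** Chosen to follow the growth of the trees: an arc with one new end is a point followed by an arc.
    Conversion into a simplicial complex is postponed to [gstruct]. *)
Inductive fgraph : set T -> Prop :=
| fgraph0 : fgraph set0
| fgraph_point Y p : fgraph Y -> fgraph (Y `|` [set p])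
| fgraph_arc Y A f a b : fgraph Y -> is_arc A f a b ->
    A `&` Y = [set a; b] -> fgraph (Y `|` A).

Lemma fgraph_set1 p : fgraph [set p].
Proof. by rewrite -(set0U [set p]); apply: fgraph_point; exact: fgraph0. Qed.

Lemma fgraph_is_arc A f a b : is_arc A f a b -> fgraph A.
Proof.
move=> hA; have [_ _ _ _ [Aa Ab _ _]] := hA.
have E : A `&` ([set a] `|` [set b]) = [set a; b].
  by apply/seteqP; split=> [x []|x [->|->]] //; split => //; [left|right].
rewrite (_ : A = [set a] `|` [set b] `|` A).
  apply: fgraph_arc hA E; apply: fgraph_point; exact: fgraph_set1.
by apply/seteqP; split=> x; [right|case=> [[->|->]|]].
Qed.

Lemma fgraphU Y Z : fgraph Y -> fgraph Z -> Y `&` Z = set0 -> fgraph (Y `|` Z).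
Proof.
move=> gY; elim=> [|{}Z p gZ IH|{}Z A f a b gZ IH hA AZ] YZ.
- by rewrite setU0.
- rewrite setUA; apply: fgraph_point; apply: IH.
  by apply/seteqP; split=> x; at_point x.
- rewrite setUA; apply: (fgraph_arc _ hA).
    by apply: IH; apply/seteqP; split=> x; at_point x.
  rewrite -AZ; apply/seteqP; split=> x; at_point x.
Qed.

End finite_graphs.

(** * Finite trees inside a continuum *)

Section trees.
Context {R : realType} {T : topologicalType}.
Context (cptT : compact [set: T]) (hT : hausdorff_space T).
Context (E : set (set T)) (En : nat -> set (set T)).
Context (hE : edge_set R E).
Context (tV : totally_disconnected ([set: T] `\` \bigcup_(e in E) e)).
Context (fEn : forall n, finite_set (En n)) (EnE : forall n, En n `<=` E)
  (hEn : forall e, E e -> exists n, En n e).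
Implicit Types (A D S Y : set T) (f : T -> R).

Definition edge_saturated Y := forall e, E e -> e `&` Y !=set0 -> closure e `<=` Y.

(** On its way from [x] into [e], the continuum must pass an end of [e], which already belongs to
    [Z]. So the piece of [A] without [e] that contains [x] meets [Z]. *)
Lemma first_hit A (x t : T) Z e : closed A -> connected A -> A x -> closed Z ->
  ~ Z x -> E e -> closure e `<=` Z -> e t -> A t ->
  exists B, [/\ B `<=` A `\` e, closed B, connected B, B x & B `&` Z !=set0].
Proof.
move=> cA coA Ax cZ nZx Ee eZ et At; have [eE tE] := hE.
have oe : open e by case: (eE _ Ee).
have ele := edge_edge_like cptT (eE _ Ee).
have [a [b [eab ca cb nea [neb ab]]]] := edge_like_bnd ele.
have se := @subset_closure _ e.
have cAe : closed (A `\` e) by apply: closedI => //; exact: open_closedC.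
have Aex : (A `\` e) x by split => // ex; apply: nZx; apply: eZ; exact: se.
have [coAe|[K [L [[cK coK] [cL coL] KL AE [Ka Lb]]]]] :=
  connected_cut cA coA oe eab (ex_intro _ x Aex).
  exists (A `\` e); split => //.
  apply: contrapT => nAZ.
  have cAce : closed (A `&` closure e) by apply: closedI => //; exact: closed_closure.
  have [|||] := connected_closedU coA cAe cAce.
  - by move=> z; at_point z.
  - apply/seteqP; split=> // z [_ [[Az nez] [_ cez]]].
    by apply: nAZ; exists z; split => //; exact: eZ.
  - by move=> AA; have := AA t At; case.
  - by move=> AA; apply: nZx; apply: eZ; case: (AA x Ax).
have : (K `|` L) x by rewrite -AE.
case=> [Kx|Lx].
  exists K; split => //; first by rewrite AE; exact: subsetUl.
  by exists a; split => //; exact: eZ.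
exists L; split => //; first by rewrite AE; exact: subsetUr.
by exists b; split => //; exact: eZ.
Qed.

Lemma finite_tree D S s0 : closed D -> connected D -> D s0 ->
  (forall e, E e -> ~ e s0) -> finite_set S -> S `<=` D ->
  (forall e, E e -> e `&` S = set0) ->
  exists Y, [/\ [/\ closed Y, connected Y & Y s0], Y `<=` D, S `<=` Y, @fgraph R T Y &
    edge_saturated Y].
Proof.
move=> cD coD Ds0 nEs0 fS; elim/finite_set_ind : S / fS => [_ _|x S fS _ IH SD ES].
  exists [set s0]; split => //.
  - split => //; [|exact: connected1].
    exact/accessible_closed_set1/hausdorff_accessible.
  - by move=> _ ->.
  - exact: fgraph_set1.
  - by move=> e Ee [z [ez zs0]]; rewrite zs0 in ez; case: (nEs0 e Ee).
have [||Y [[cY coY Ys0] YD SY gY satY]] := IH.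
- by move=> z Sz; apply: SD; right.
- move=> e Ee; have := ES e Ee => e0; apply/seteqP; split => // z [ez Sz].
  by rewrite -e0; split => //; right.
have [Yx|nYx] := pselect (Y x).
  by exists Y; split => // z [->|/SY].
have Dx : D x by apply: SD; left.
have nEx e : E e -> ~ e x.
  by move=> Ee ex; have : (e `&` (x |` S)) x by [split => //; left]; rewrite ES.
have jD : joined D x Y by apply: joined_connected => //; exists s0.
have [A [[AD cA coA Ax [t [At Yt]]] Amin]] := irreducible cptT hT cD Dx cY jD.
have xt : x <> t by move=> xt; apply: nYx; rewrite xt.
(* If [t] were inside an edge, saturation would put the closure of that edge in [Y], and [first_hit]
   would give a smaller continuum from [x] to [Y]. *)
have nEt e : E e -> ~ e t.
  move=> Ee et; have eY : closure e `<=` Y by apply: satY => //; exists t.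
  have [B [BA cB coB Bx BY]] := first_hit cA coA Ax cY nYx Ee eY et At.
  have BE : B = A by apply: Amin => // z /BA[].
  by have := BA t; rewrite BE => /(_ At)[].
have irr : irreducible_between A x t.
  by split => // B BA cB coB Bx Bt; apply: Amin => //; exists t.
have [|[f hA] satA] := irreducible_arc cptT hT hE tV fEn EnE hEn irr _ xt.
  by move=> e Ee; split; [exact: nEx|exact: nEt].
have [_ cf If _ [_ _ fx ft]] := hA.
(* The segment of [A] from [x] to any point [t'] of [Y] already joins [x] to [Y]; by minimality it
   is all of [A], so [t'] is the end [t]. *)
have AY : A `&` Y = [set t].
  apply/seteqP; split=> [t' [At' Yt']|_ ->//].
  pose B := A `&` f @^-1` [set r | r <= f t'].
  have BE : B = A.
    apply: Amin; first exact: subIsetl.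
    - by move/(within_closedP f cA) : cf; apply; exact: closed_le.
    - apply: (arc_connected cptT hA) => r1 r2 _ /= r2t r /andP[_ rr2].
      exact: le_trans rr2 r2t.
    - by split => //=; rewrite fx; have /andP[] := arc_itv hA At'.
    - by exists t'; split => //; split => //=.
  have [_ /= h] : B t by rewrite BE.
  apply: If => //; apply/eqP; rewrite eq_le h ft andbT.
  by have /andP[] := arc_itv hA At'.
exists (Y `|` A); split.
- split; [exact: closedU| |by left].
  by apply: connectedU => //; exists t.
- by rewrite subUset.
- by move=> z [->|/SY]; [right|left].
- rewrite (_ : Y `|` A = Y `|` [set x] `|` A).
    apply: (fgraph_arc _ hA); first exact: fgraph_point.
    rewrite setIUr AY setUC; apply/seteqP; split=> z.
      by case=> [[]|]; [left|right].
    by case=> ->; [left|right].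
  by apply/seteqP; split=> z; [case; [left; left|right]|case=> [[|->]|]; [left|right|right]].
- move=> e Ee [z [ez [Yz|Az]]].
    by move=> w /(satY e Ee (ex_intro _ z (conj ez Yz))); left.
  by move=> w /(satA e Ee (ex_intro _ z (conj ez Az))); right.
Qed.

End trees.

Lemma within_bigcup_finite (U V : topologicalType) (I : choiceType) (D : set I)
    (F : I -> set U) (h : U -> V) : finite_set D ->
  (forall i, D i -> closed (F i)) -> (forall i, D i -> {within F i, continuous h}) ->
  {within \bigcup_(i in D) F i, continuous h}.
Proof.
move=> fD; elim/finite_set_ind : D / fD => [_ _|i D fD _ IH cF hF].
  by rewrite bigcup_set0; exact: continuous_subspace0.
rewrite bigcup_setU bigcup_set1; apply: withinU_continuous.
- by apply: cF; left.
- by apply: closed_bigcup => // j Dj; apply: cF; right.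
- by apply: hF; left.
- by apply: IH => j Dj; [apply: cF|apply: hF]; right.
Qed.

Lemma homeomorphic_embedding (U V : topologicalType) (Y : set U) (h : U -> V) :
  hausdorff_space V -> compact Y -> closed Y -> {within Y, continuous h} ->
  (forall x y, Y x -> Y y -> h x = h y -> x = y) ->
  homeomorphic (set_type Y) (set_type (h @` Y)).
Proof.
move=> hV cY clY ch hI.
have hY (z : Y) : (h @` Y) (h (set_val z)) by exists (set_val z) => //; exact: set_valP.
have gY (w : h @` Y) : exists z : Y, h (set_val z) = set_val w.
  by have [x Yx hx] := set_valP w; exists (SigSub (mem_set Yx)).
pose F (z : Y) : (h @` Y : Type) := SigSub (mem_set (hY z)).
have /choice[G GE] := gY.
have vF z : set_val (F z) = h (set_val z) by [].
have val_injY (z z' : Y) : set_val z = set_val z' -> z = z' by move=> /val_inj.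
have GF : cancel F G.
  by move=> z; apply: val_injY; apply: hI; [exact: set_valP|exact: set_valP|rewrite GE].
have FG : cancel G F.
  by move=> w; apply: val_inj; rewrite /= -[RHS]GE.
have cF : continuous F.
  apply: (@continuous_comp_initial _ _ _ set_val).
  by have /subspace_sigL_continuousP := ch.
exists F, G; split => //.
apply: (@continuous_comp_initial _ _ _ set_val).
apply/continuous_closedP => C cC.
have cVC : closed (h @` (Y `&` C)).
  apply: compact_closed => //; apply: continuous_compact.
    by apply: continuous_subspaceW ch; exact: subIsetl.
  exact: compact_closedI.
have -> : (set_val \o G) @^-1` C = set_val @^-1` (h @` (Y `&` C)).
  apply/seteqP; split=> w /=.
    by move=> Cw; exists (set_val (G w)); rewrite ?GE//; split => //; exact: set_valP.
  move=> [x [Yx Cx] hx]; rewrite (_ : set_val (G w) = x) //.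
  by apply: hI => //; [exact: set_valP|rewrite GE].
by move: cVC; apply: preimage_closed => w _; exact: initial_continuous.
Qed.

(** * Vertices and arcs of a simple graph *)

Section graph_structure.
Context {R : realType} {T : topologicalType}.
Implicit Types (A Y W : set T) (f : T -> R).

Definition garc : Type := (set T * (T -> R) * T * T)%type.
Implicit Types (l : garc) (L : set garc).

Definition asup l := l.1.1.1.
Definition afun l := l.1.1.2.
Definition abeg l := l.1.2.
Definition aend l := l.2.

(* Distinct arcs share at most one point, so that the graph is simple. *)
Definition gstruct Y W L :=
  [/\ finite_set W /\ finite_set L, Y = W `|` \bigcup_(l in L) asup l,
      forall l, L l -> is_arc (asup l) (afun l) (abeg l) (aend l),
      forall l, L l -> [/\ W (abeg l), W (aend l) &
        asup l `&` W `<=` [set abeg l; aend l]] &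
      forall l l', L l -> L l' -> l <> l' -> asup l `&` asup l' `<=` W /\
        forall x y, (asup l `&` asup l') x -> (asup l `&` asup l') y -> x = y].

Lemma gstruct_new_point Y W L p : gstruct Y W L -> ~ Y p ->
  gstruct (Y `|` [set p]) (W `|` [set p]) L.
Proof.
move=> [[fW fL] YE hL hW hLL] nYp; split => //.
- by split => //; rewrite finite_setU; split => //; exact: finite_set1.
- by rewrite YE -!setUA (setUC [set p]).
- move=> l Ll; have [Wb We Wl] := hW l Ll; split; [by left|by left|].
  move=> x [lx [Wx|xp]]; first exact: Wl.
  by case: nYp; rewrite YE; right; exists l => //; rewrite -xp.
- move=> l l' Ll Ll' ll'; have [h1 h2] := hLL l l' Ll Ll' ll'; split => //.
  by move=> x /h1; left.
Qed.

Lemma gstruct_point Y W L p : gstruct Y W L -> exists W' L',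
  [/\ gstruct (Y `|` [set p]) W' L', W `<=` W' & W' p].
Proof.
move=> gY; have [[fW fL] YE hL hW hLL] := gY.
have [Yp|nYp] := pselect (Y p); last first.
  exists (W `|` [set p]), L; split; [exact: gstruct_new_point|by left|by right].
rewrite (setUidl (_ : [set p] `<=` Y)); last by move=> _ ->.
have [Wp|nWp] := pselect (W p); first by exists W, L; split.
(* In the remaining case [p] is an inner point of an arc [l0], which is replaced by its two halves
   [l1] and [l2]. *)
have [l0 Ll0 l0p] : (\bigcup_(l in L) asup l) p by move: Yp; rewrite YE; case.
have hA := hL _ Ll0; have [Wb We Wl0] := hW _ Ll0.
have [cA cf If fA [Aa Ab fa fb]] := hA.
set A := asup l0 in hA cA cf If fA Aa Ab l0p *.
set f := afun l0 in hA cf If fA fa fb *.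
set a := abeg l0 in hA Wb Aa fa Wl0 *; set b := aend l0 in hA We Ab fb Wl0 *.
have /andP[p0 p1] := arc_itv hA l0p.
have fp0 : f a < f p.
  rewrite fa lt_neqAle p0 andbT; apply/eqP => e0; apply: nWp.
  by rewrite (_ : p = a) //; apply: If; rewrite // fa.
have fp1 : f p < f b.
  rewrite fb lt_neqAle p1 andbT; apply/eqP => e0; apply: nWp.
  by rewrite (_ : p = b) //; apply: If; rewrite // fb.
have hA1 := subarc hA Aa l0p fp0; have hA2 := subarc hA l0p Ab fp1.
pose l1 : garc := (A `&` f @^-1` `[f a, f p], fun z => (f z - f a) / (f p - f a), a, p).
pose l2 : garc := (A `&` f @^-1` `[f p, f b], fun z => (f z - f p) / (f b - f p), p, b).
have l1A : asup l1 `<=` A by move=> z [].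
have l2A : asup l2 `<=` A by move=> z [].
have l1f z : asup l1 z -> f z <= f p by move=> [_] /=; rewrite in_itv /= => /andP[].
have l2f z : asup l2 z -> f p <= f z by move=> [_] /=; rewrite in_itv /= => /andP[].
have A12 z : A z -> asup l1 z \/ asup l2 z.
  move=> Az; have /andP[z0 z1] := arc_itv hA Az.
  have [zp|pz] := leP (f z) (f p); [left|right]; split => //=; rewrite in_itv /=.
    by rewrite zp fa z0.
  by rewrite (ltW pz) fb z1.
have i12 z : asup l1 z -> asup l2 z -> z = p.
  move=> z1 z2; apply: If; [exact: l1A|by []|].
  by apply/eqP; rewrite eq_le l1f// l2f.
exists (W `|` [set p]), ((L `\ l0) `|` [set l1; l2]); split; [|by left|by right].
have new l l' : (L `\ l0) l -> l' = l1 \/ l' = l2 ->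
    asup l `&` asup l' `<=` asup l `&` A.
  by move=> _ [->|->] z [lz z']; split => //; [exact: l1A|exact: l2A].
split.
- split; rewrite finite_setU; first by split => //; exact: finite_set1.
  by split; [exact: finite_setD|exact: finite_set2].
- rewrite YE; apply/seteqP; split=> z.
    case=> [Wz|[l Ll lz]]; first by left; left.
    have [ll0|ll0] := pselect (l = l0).
      by rewrite ll0 in lz; case: (A12 z lz) => hz; right;
        [exists l1 => //; right; left|exists l2 => //; right; right].
    by right; exists l => //; left.
  case=> [[Wz|->]|[l [[Ll _]|[->|->]] lz]].
  + by left.
  + by right; exists l0.
  + by right; exists l.
  + by right; exists l0 => //; exact: l1A.
  + by right; exists l0 => //; exact: l2A.
- by move=> l [[Ll _]|[->|->]] //; exact: hL.
- move=> l [[Ll ll0]|[->|->]].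
  + have [h1 h2 h3] := hW l Ll; split; [by left|by left|].
    move=> z [lz [Wz|zp]]; first exact: h3.
    exfalso; apply: nWp; have [h4 _] := hLL l l0 Ll Ll0 ll0.
    by apply: h4; split => //; rewrite -zp.
  + split; [by left|by right|].
    move=> z [z1 [Wz|zp]]; last by right.
    have [||] // := Wl0 z; first by split => //; exact: l1A.
      by left.
    by move=> zb; move: (l1f z z1); rewrite zb leNgt fp1.
  + split; [by right|by left|].
    move=> z [z1 [Wz|zp]]; last by left.
    have [||] // := Wl0 z; first by split => //; exact: l2A.
      by move=> za; move: (l2f z z1); rewrite za leNgt fp0.
    by right.
- have sub l l' : (L `\ l0) l -> l' = l1 \/ l' = l2 ->
    asup l `&` asup l' `<=` W `|` [set p] /\
        forall x y, (asup l `&` asup l') x -> (asup l `&` asup l') y -> x = y.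
    move=> Ll l'E; have := new l l' Ll l'E; case: Ll => Ll ll0 nl.
    have [h1 h2] := hLL l l0 Ll Ll0 ll0; split; first by move=> z /nl/h1; left.
    by move=> x y /nl hx /nl hy; exact: h2.
  have sym l l' : asup l `&` asup l' = asup l' `&` asup l by rewrite setIC.
  move=> l l' hl hl' ll'.
  case: hl => [Ll|lE]; case: hl' => [Ll'|l'E].
  + case: Ll => Ll _; case: Ll' => Ll' _.
    have [h1 h2] := hLL l l' Ll Ll' ll'; split => //.
    by move=> z /h1; left.
  + exact: sub.
  + by rewrite sym; exact: sub.
  + have i l3 l4 : l3 = l1 /\ l4 = l2 -> asup l3 `&` asup l4 `<=` W `|` [set p] /\
        forall x y, (asup l3 `&` asup l4) x -> (asup l3 `&` asup l4) y -> x = y.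
      move=> [-> ->]; split; first by move=> z [z1 z2]; right; exact: i12.
      by move=> x y [x1 x2] [y1 y2]; rewrite (i12 x)// (i12 y).
    case: lE l'E => lE [] l'E.
    * by exfalso; apply: ll'; rewrite lE l'E.
    * by apply: i.
    * by rewrite sym; apply: i.
    * by exfalso; apply: ll'; rewrite lE l'E.
Qed.

Lemma gstruct_arc Y W L l : gstruct Y W L ->
  is_arc (asup l) (afun l) (abeg l) (aend l) -> W (abeg l) -> W (aend l) ->
  asup l `&` Y `<=` [set abeg l; aend l] ->
  (forall l', L l' -> ~ (asup l' (abeg l) /\ asup l' (aend l))) ->
  gstruct (Y `|` asup l) W (L `|` [set l]).
Proof.
move=> [[fW fL] YE hL hW hLL] hl Wb We lY nadj.
have WY : W `<=` Y by rewrite YE; exact: subsetUl.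
have LY l' : L l' -> asup l' `<=` Y by move=> Ll' z z'; rewrite YE; right; exists l'.
have key l' : L l' -> asup l `&` asup l' `<=` W /\
    forall x y, (asup l `&` asup l') x -> (asup l `&` asup l') y -> x = y.
  move=> Ll'; have h z : (asup l `&` asup l') z -> z = abeg l \/ z = aend l.
    by move=> [lz l'z]; apply: lY; split => //; exact: LY l'z.
  split; first by move=> z /h[->|->].
  have nadj' := nadj l' Ll'; move=> x y hx hy.
  case: (h x hx) => xE; case: (h y hy) => yE; rewrite xE yE // in hx hy *; exfalso;
    by apply: nadj'; case: hx => _ hx; case: hy => _ hy.
split.
- by split => //; rewrite finite_setU; split => //; exact: finite_set1.
- by rewrite YE bigcup_setU bigcup_set1 setUA.
- by move=> l' [/hL|->].
- move=> l' [/hW//|->]; split => // z [lz Wz]; apply: lY; split => //.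
  exact: WY.
- move=> l1 l2 [L1|->] [L2|->] l12 //.
  + exact: hLL.
  + by rewrite setIC; exact: key.
  + exact: key.
Qed.

End graph_structure.

Section realization.
Context {R : realType} {T : topologicalType}.
Implicit Types (A Y W : set T) (f : T -> R) (l : @garc R T) (L : set (@garc R T)).

(* Subdividing the new arc into thirds keeps the graph simple. *)
Lemma gstruct_adjoin Y W L A f a b : gstruct Y W L -> is_arc A f a b ->
  A `&` Y = [set a; b] -> exists W' L', gstruct (Y `|` A) W' L'.
Proof.
move=> gY hA AY; have [cA cf If fA [Aa Ab fa fb]] := hA.
have Ya : Y a by have : [set a; b] a by [left]; rewrite -AY => -[].
have Yb : Y b by have : [set a; b] b by [right]; rewrite -AY => -[].
have [W1 [L1 [g1 _ W1a]]] := gstruct_point a gY.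
have [W2 [L2 [g2 W12 W2b]]] := gstruct_point b g1.
rewrite (setUidl (_ : [set a] `<=` Y)) in g1 g2; last by move=> _ ->.
rewrite (setUidl (_ : [set b] `<=` Y)) in g2; last by move=> _ ->.
have {W12 W1a} W2a : W2 a by exact: W12.
have t0 : 0 < 1 / 3 :> R by lra.
have t1 : 1 / 3 < 1 :> R by lra.
have t12 : 1 / 3 < 2 / 3 :> R by lra.
have t2 : 2 / 3 < 1 :> R by lra.
have [|p Ap fp] := arc_preimage hA (t := 1 / 3); first by rewrite (ltW t0) (ltW t1).
have [|q Aq fq] := arc_preimage hA (t := 2 / 3).
  by rewrite (ltW (lt_trans t0 t12)) (ltW t2).
have fY z : A z -> Y z -> f z = 0 \/ f z = 1.
  by move=> Az Yz; have : (A `&` Y) z by []; rewrite AY => -[->|->]; [left|right].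
have nYp : ~ Y p by move=> /(fY p Ap); rewrite fp => -[]; lra.
have nYq : ~ (Y `|` [set p]) q.
  by case=> [/(fY q Aq)|qp]; [rewrite fq => -[]; lra|move: fq; rewrite qp fp; lra].
have g3 := gstruct_new_point (gstruct_new_point g2 nYp) nYq.
have ap : f a < f p by rewrite fa fp.
have pq : f p < f q by rewrite fp fq.
have qb : f q < f b by rewrite fq fb.
have hA1 := subarc hA Aa Ap ap; have hA2 := subarc hA Ap Aq pq.
have hA3 := subarc hA Aq Ab qb.
pose l1 : garc := (A `&` f @^-1` `[f a, f p], fun z => (f z - f a) / (f p - f a), a, p).
pose l2 : garc := (A `&` f @^-1` `[f p, f q], fun z => (f z - f p) / (f q - f p), p, q).
pose l3 : garc := (A `&` f @^-1` `[f q, f b], fun z => (f z - f q) / (f b - f q), q, b).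
have i1 z : asup l1 z <-> A z /\ 0 <= f z <= 1 / 3.
  by rewrite /asup /= /setI /= in_itv /= fa fp.
have i2 z : asup l2 z <-> A z /\ 1 / 3 <= f z <= 2 / 3.
  by rewrite /asup /= /setI /= in_itv /= fq fp.
have i3 z : asup l3 z <-> A z /\ 2 / 3 <= f z <= 1.
  by rewrite /asup /= /setI /= in_itv /= fq fb.
have eqz z w : A z -> A w -> f z = f w -> z = w by exact: If.
have LY l : L2 l -> asup l `<=` Y.
  by case: g2 => _ -> _ _ _ Ll z lz; right; exists l.
have g4 : gstruct (Y `|` [set p] `|` [set q] `|` asup l1)
    (W2 `|` [set p] `|` [set q]) (L2 `|` [set l1]).
  apply: gstruct_arc => //.
  - by left; left.
  - by left; right.
  - move=> z [/i1[Az /andP[z0 z1]] [[Yz|zp]|zq]].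
    + case: (fY z Az Yz) => fz; [left; apply: eqz; rewrite // fa fz//|move: z1; rewrite fz; lra].
    + by right.
    + by move: z1; rewrite zq fq; lra.
  - by move=> l Ll [_ /(LY l Ll)].
have g5 : gstruct (Y `|` [set p] `|` [set q] `|` asup l1 `|` asup l2)
    (W2 `|` [set p] `|` [set q]) (L2 `|` [set l1] `|` [set l2]).
  apply: gstruct_arc => //.
  - by left; right.
  - by right.
  - move=> z [/i2[Az /andP[z0 z1]] [[[Yz|zp]|zq]|/i1[_ /andP[z0' z1']]]].
    + case: (fY z Az Yz) => fz; [move: z0|move: z1]; rewrite fz; lra.
    + by left.
    + by right.
    + by left; apply: eqz => //; rewrite fp; lra.
  - move=> l [Ll|->] [_ /=].
      by move=> /(LY l Ll) Yq; apply: nYq; left.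
    by move=> /i1[_]; rewrite fq => /andP[]; lra.
have g6 : gstruct (Y `|` [set p] `|` [set q] `|` asup l1 `|` asup l2 `|` asup l3)
    (W2 `|` [set p] `|` [set q]) (L2 `|` [set l1] `|` [set l2] `|` [set l3]).
  apply: gstruct_arc => //.
  - by right.
  - by left; left.
  - move=> z [/i3[Az /andP[z0 z1]] [[[[Yz|zp]|zq]|/i1[_ /andP[z0' z1']]]|/i2[_ /andP[z0' z1']]]].
    + case: (fY z Az Yz) => fz; [move: z0; rewrite fz; lra|].
      by right; apply: eqz; rewrite // fb.
    + by move: z0; rewrite zp fp; lra.
    + by left.
    + by have := le_trans z0 z1'; rewrite leNgt t12.
    + by left; apply: eqz => //; rewrite fq; lra.
  - move=> l [[Ll|->]|->] [/= h1 h2].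
    + by apply: nYq; left; exact: LY h1.
    + by move: h1 => /i1[_]; rewrite fq => /andP[]; lra.
    + by move: h2 => /i2[_]; rewrite fb => /andP[]; lra.
exists (W2 `|` [set p] `|` [set q]), (L2 `|` [set l1] `|` [set l2] `|` [set l3]).
rewrite (_ : Y `|` A = Y `|` [set p] `|` [set q] `|` asup l1 `|` asup l2 `|` asup l3) //.
apply/seteqP; split=> z.
  case=> [Yz|Az]; first by do 5!left.
  have /andP[z0 z1] := arc_itv hA Az.
  have [h|h] := leP (f z) (1 / 3).
    by left; left; right; apply/i1; split => //; rewrite z0.
  have [h'|h'] := leP (f z) (2 / 3).
    by left; right; apply/i2; split => //; rewrite (ltW h).
  by right; apply/i3; split => //; rewrite (ltW h').
by case=> [[[[[Yz|->]|->]|/i1[]]|/i2[]]|/i3[]]; [left|right..].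
Qed.

Lemma fgraph_gstruct Y : @fgraph R T Y -> exists W L, gstruct Y W L.
Proof.
elim=> [|{}Y p _ [W [L gY]]|{}Y A f a b _ [W [L gY]] hA AY].
- exists set0, set0; split => //.
  by rewrite bigcup_set0 setU0.
- by have [W' [L' [g _ _]]] := gstruct_point p gY; exists W', L'.
- exact: gstruct_adjoin gY hA AY.
Qed.

Context (cptT : compact [set: T]) (hT : hausdorff_space T).

Lemma closed_point (x : T) : closed [set x].
Proof. exact/accessible_closed_set1/hausdorff_accessible. Qed.

Lemma gstruct_closed Y W L : gstruct Y W L -> closed Y.
Proof.
move=> [[fW fL] -> hL _ _]; apply: closedU.
  by apply: compact_closed => //; exact: finite_compact.
by apply: closed_bigcup => // l /hL/arc_closed.
Qed.

(** * Embedding into the geometric realization *)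

Section embedding.
Context (Y W : set T) (L : set (@garc R T)) (s : seq T).
Context (gY : gstruct Y W L).
Context (WE : W = [set` s]).
Context (us : uniq s).

Let n := size s.
Let vtx (i : 'I_n) : T := tnth (in_tuple s) i.
Let vec (y : T) : 'rV[R]_n := \row_(j < n) (vtx j == y)%:R.
Let bary (l : @garc R T) (y : T) : 'rV[R]_n :=
  (1 - afun l y) *: vec (abeg l) + afun l y *: vec (aend l).
(** A point of [Y] that is not a vertex lies on exactly one arc, so the arc picked by [xget] is
    forced; the default value only concerns points outside [Y]. *)
Let h (y : T) : 'rV[R]_n := if pselect (W y) then vec y
  else bary (xget (set0, cst 0, y, y) [set l | L l /\ asup l y]) y.
Let adj : rel 'I_n := fun i j => `[< exists2 l, L l &
  (abeg l = vtx i /\ aend l = vtx j) \/ (abeg l = vtx j /\ aend l = vtx i)>].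

Let vtx_inj i j : vtx i = vtx j -> i = j.
Proof.
move=> /eqP; rewrite /vtx !(tnth_nth (vtx i)) /= nth_uniq// => /eqP ij.
exact: val_inj.
Qed.

Let vtxP x : W x -> exists i, vtx i = x.
Proof.
rewrite WE /= => xs; have xn : (index x s < n)%N by rewrite index_mem.
by exists (Ordinal xn); rewrite /vtx (tnth_nth x) /= nth_index.
Qed.

Let Wvtx i : W (vtx i).
Proof. by rewrite WE /=; exact: mem_tnth. Qed.

Let vec_vtx i : vec (vtx i) = delta_mx ord0 i.
Proof.
apply/rowP => j; rewrite !mxE eqxx /=; congr ((_ : bool)%:R).
by apply/eqP/eqP => [/vtx_inj|->].
Qed.

Let bary_coord l i y : bary l y ord0 i =
  (1 - afun l y) * (vtx i == abeg l)%:R + afun l y * (vtx i == aend l)%:R.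
Proof. by rewrite !mxE. Qed.

Let hW y : W y -> h y = vec y.
Proof. by rewrite /h; case: (pselect (W y)). Qed.

Let hL l y : L l -> asup l y -> h y = bary l y.
Proof.
move=> Ll ly; have [_ _ harc hWl hLL] := gY.
have [_ _ If _ [lb le fb fe]] := harc l Ll.
have [Wy|nWy] := pselect (W y).
  rewrite hW//; have [_ _ Wl] := hWl l Ll.
  have [->|->] := Wl y (conj ly Wy); rewrite /bary.
    by rewrite fb subr0 scale1r scale0r addr0.
  by rewrite fe subrr scale1r scale0r add0r.
rewrite /h; case: (pselect (W y)) => // _ /=.
case: xgetP => [l' _ [Ll' l'y]|/(_ l) []//].
have [->//|l'l] := pselect (l' = l).
by have [/(_ y (conj l'y ly))] := hLL l' l Ll' Ll l'l.
Qed.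

Let end_neq l : L l -> abeg l <> aend l.
Proof. by have [_ _ harc _ _] := gY; move=> /harc/arc_neq. Qed.

Lemma h_cont : {within Y, continuous h}.
Proof.
have [[fW fL] YE harc _ _] := gY.
rewrite YE; apply: withinU_continuous.
- by apply: compact_closed => //; exact: finite_compact.
- by apply: closed_bigcup => // l /harc/arc_closed.
- rewrite (_ : W = \bigcup_(x in W) [set x]); last first.
    by apply/seteqP; split=> [x Wx|x [y Wy ->]] //; exists x.
  apply: within_bigcup_finite => // x _; first exact: closed_point.
  exact: continuous_subspace1.
- apply: within_bigcup_finite => // [l /harc/arc_closed//|l Ll].
  apply: (@subspace_eq_continuous _ _ _ (bary l)).
    by move=> x /set_mem lx; apply/esym; exact: hL.
  have [_ cf _ _ _] := harc l Ll.
  move=> x; apply: cvgD; apply: cvgZr_tmp; last exact: cf.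
  by apply: cvgB; [exact: cvg_cst|exact: cf].
Qed.

(** The non-zero coordinates of [h z] name the cell of [z]: one for a vertex, the two ends for an
    inner point of an arc. Two arcs with the same ends share two points, so they coincide, and the
    coordinate on the arc decides. *)
Lemma h_inj x y : Y x -> Y y -> h x = h y -> x = y.
Proof.
have [[fW fL] YE harc hWl hLL] := gY.
have cases z : Y z -> W z \/ exists l, [/\ L l, asup l z, ~ W z & 0 < afun l z < 1].
  rewrite YE => -[Wz|[l Ll lz]]; first by left.
  have [Wz|nWz] := pselect (W z); first by left.
  right; exists l; split=> //.
  have [_ _ If _ [lb le fb fe]] := harc l Ll; have [Wb We _] := hWl l Ll.
  have /andP[z0 z1] := arc_itv (harc l Ll) lz.
  rewrite !lt_neqAle z0 z1 !andbT; apply/andP; split; apply/eqP => fz; apply: nWz.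
    by rewrite (If z (abeg l)) // fb.
  by rewrite (If z (aend l)) // fe.
have vecWi z i : W z -> vec z ord0 i = (vtx i == z)%:R by rewrite mxE.
have sup l z i : L l -> asup l z -> 0 < afun l z < 1 ->
    (h z ord0 i != 0) = (vtx i == abeg l) || (vtx i == aend l).
  move=> Ll lz /andP[z0 z1]; rewrite (hL Ll lz) bary_coord.
  have [ib|_] := eqVneq (vtx i) (abeg l).
    have -> : (vtx i == aend l) = false by apply/eqP; rewrite ib; exact: end_neq.
    by rewrite mulr1 mulr0 addr0 /= gt_eqF// subr_gt0.
  by rewrite mulr0 add0r; case: (vtx i == aend l); rewrite ?mulr1 ?mulr0 ?eqxx ?(gt_eqF z0).
have mixed z w l : W z -> L l -> asup l w -> 0 < afun l w < 1 -> h z <> h w.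
  move=> Wz Ll lw w01 zw; have [Wb We _] := hWl l Ll.
  have [i ib] := vtxP Wb; have [j je] := vtxP We.
  have : h w ord0 i != 0 by rewrite (sup l)// ib eqxx.
  have : h w ord0 j != 0 by rewrite (sup l)// je eqxx orbT.
  rewrite -zw hW// !vecWi// !pnatr_eq0 !eqb0 !negbK => /eqP jz /eqP iz.
  by apply: (end_neq Ll); rewrite -ib -je iz jz.
move=> Yx Yy hxy; case: (cases x Yx) (cases y Yy) => [Wx|[l [Ll lx nWx x01]]]
  [Wy|[l' [Ll' ly nWy y01]]].
- have [i ix] := vtxP Wx; have := congr1 (fun v : 'rV[R]_n => v ord0 i) hxy.
  rewrite !hW// !vecWi// ix eqxx; case: eqP => // _ /eqP.
  by rewrite oner_eq0.
- by case: (mixed x y l').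
- by case: (mixed y x l).
- have [Wb We _] := hWl l Ll; have [Wb' We' _] := hWl l' Ll'.
  have [i ib] := vtxP Wb; have [j je] := vtxP We.
  have bl : abeg l = abeg l' \/ abeg l = aend l'.
    have : h y ord0 i != 0 by rewrite -hxy (sup l)// ib eqxx.
    by rewrite (sup l')// ib => /orP[] /eqP; [left|right].
  have el : aend l = abeg l' \/ aend l = aend l'.
    have : h y ord0 j != 0 by rewrite -hxy (sup l)// je eqxx orbT.
    by rewrite (sup l')// je => /orP[] /eqP; [left|right].
  have [_ _ If _ [lb le _ _]] := harc l Ll; have [_ _ _ _ [lb' le' _ _]] := harc l' Ll'.
  have ll' : l = l'.
    apply: contrapT => ll'; have [_ one] := hLL l l' Ll Ll' ll'.
    apply: (end_neq Ll); apply: one; split => //.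
      by case: bl => ->.
    by case: el => ->.
  apply: If => //; first by rewrite ll'.
  have := congr1 (fun v : 'rV[R]_n => v ord0 j) hxy.
  rewrite (hL Ll lx) ll' (hL Ll' ly) !bary_coord -ll' je eqxx.
  have -> : (aend l == abeg l) = false by apply/eqP/nesym; exact: end_neq.
  by rewrite !mulr0 !mulr1 !add0r.
Qed.

Lemma h_image : h @` Y = realization R adj.
Proof.
have [[fW fL] YE harc hWl hLL] := gY.
apply/seteqP; split=> p.
  move=> [y]; rewrite YE => -[Wy|[l Ll ly]] <-.
    have [i <-] := vtxP Wy; left; exists i; rewrite hW ?vec_vtx//.
  right; have [Wb We _] := hWl l Ll; have [i ib] := vtxP Wb; have [j je] := vtxP We.
  exists i, j, (afun l y); split.
  - by apply/asboolP; exists l => //; left; rewrite ib je.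
  - exact: arc_itv (harc l Ll) ly.
  - by rewrite (hL Ll ly) /bary -ib -je !vec_vtx.
case=> [[i ->]|[i [j [t [/asboolP[l Ll lij] t01 ->]]]]].
  exists (vtx i); first by rewrite YE; left.
  by rewrite hW// vec_vtx.
case: lij => -[b e].
  have [y ly fy] := arc_preimage (harc l Ll) t01; exists y.
    by rewrite YE; right; exists l.
  by rewrite (hL Ll ly) /bary b e !vec_vtx fy.
have [|y ly fy] := arc_preimage (harc l Ll) (t := 1 - t).
  by case/andP: t01 => t0 t1; rewrite subr_ge0 t1 gerBl.
exists y; first by rewrite YE; right; exists l.
by rewrite (hL Ll ly) /bary b e !vec_vtx fy subKr addrC.
Qed.

Lemma gstruct_finite_graph : finite_graph R (set_type Y).
Proof.
exists n, adj; split.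
- by move=> i j; apply/asboolP/asboolP => -[l Ll lij]; exists l => //; tauto.
- move=> i; apply/negbTE/negP => /asboolP[l Ll] lij; apply: (end_neq Ll).
  by case: lij => -[-> ->].
- rewrite -h_image; have cY := gstruct_closed gY.
  apply: homeomorphic_embedding => //.
  + exact: closed_cpt.
  + exact: h_cont.
  + exact: h_inj.
Qed.

End embedding.

Lemma fgraph_finite_graph Y : @fgraph R T Y -> finite_graph R (set_type Y) /\ closed Y.
Proof.
move=> /fgraph_gstruct[W [L gY]]; split; last exact: gstruct_closed gY.
have [[/finite_seqP[s WE] _] _ _ _ _] := gY.
apply: (gstruct_finite_graph gY (s := undup s)); last exact: undup_uniq.
by rewrite WE; apply/seteqP; split=> x /=; rewrite mem_undup.
Qed.

End realization.

(** * The approximating graphs *)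

Section subgraphs.
Context {R : realType} {T : topologicalType}.
Context (cptT : compact [set: T]) (hT : hausdorff_space T).
Context (E : set (set T)) (En : nat -> set (set T)).
Context (hE : edge_set R E).
Context (tV : totally_disconnected ([set: T] `\` \bigcup_(e in E) e)).
Context (fEn : forall n, finite_set (En n)) (EnE : forall n, En n `<=` E)
  (hEn : forall e, E e -> exists n, En n e).
Implicit Types (A S Y P : set T) (f : T -> R) (D : set (set T)).

(** The coordinate has a minimum and a maximum on [P]; if they agree [P] is a point, otherwise it is
    the subarc between them. *)
Lemma subarc_fgraph A f a b P : is_arc A f a b -> P `<=` A -> closed P ->
  connected P -> P !=set0 -> @fgraph R T P.
Proof.
move=> hA PA cP coP P0; have [cA cf If fA _] := hA.
have cfP : {within P, continuous f} by exact: continuous_subspaceW cf.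
have cptP := closed_cpt cptT cP.
have [x /set_mem Px xmin] := compact_EVT_min P0 cptP cfP.
have [y /set_mem Py ymax] := compact_EVT_max P0 cptP cfP.
have xy : f x <= f y by apply: xmin; exact: mem_set.
have [fxy|fxy] := eqVneq (f x) (f y).
  rewrite (_ : P = [set x]); first exact: fgraph_set1.
  apply/seteqP; split=> [z Pz|_ ->//]; apply: If; [exact: PA|exact: PA|].
  apply/eqP; rewrite eq_le xmin ?inE// andbT fxy; apply: ymax; exact: mem_set.
have {}xy : f x < f y by rewrite lt_neqAle fxy.
have hP := subarc hA (PA x Px) (PA y Py) xy.
rewrite (_ : P = A `&` f @^-1` `[f x, f y]); first exact: fgraph_is_arc hP.
apply/seteqP; split=> [z Pz|z [Az]] /=; rewrite in_itv /=.
  by split; [exact: PA|rewrite xmin ?inE// ymax ?inE].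
move=> fz; have : is_interval (f @` P).
  exact/connected_intervalP/connected_continuous_connected.
move=> iP; have [|||w Pw fw] := iP (f x) (f y) _ _ (f z).
- by exists x.
- by exists y.
- exact: fz.
- by rewrite (_ : z = w) //; apply: If => //; exact: PA.
Qed.

Lemma piece_fgraph P S : closed P -> connected P -> P !=set0 -> finite_set S ->
  S `<=` P -> (forall e, E e -> e `&` S = set0) ->
  exists Y, [/\ Y `<=` P, closed Y /\ connected Y, Y !=set0 /\ S `<=` Y, @fgraph R T Y &
    forall A f a b, is_arc A f a b -> P `<=` A -> Y = P].
Proof.
move=> cP coP P0 fS SP ES.
have [[A [f [a [b [hA PA]]]]]|nA] :=
    pselect (exists A f a b, is_arc A f a b /\ P `<=` A).
  by exists P; split => //; exact: subarc_fgraph hA PA cP coP P0.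
have nA' Y A f a b : is_arc A f a b -> P `<=` A -> Y = P.
  by move=> hA PA; case: nA; exists A, f, a, b.
have [[s0 Ss0]|nS] := pselect (S !=set0); last first.
  case: P0 => p Pp; exists [set p]; split=> //.
  - by move=> _ ->.
  - by split; [exact: closed_point|exact: connected1].
  - by split; [exists p|move=> s Ss; case: nS; exists s].
  - exact: fgraph_set1.
  - exact: nA'.
have [|Y [[cY coY Ys0] YP SY gY _]] :=
    finite_tree cptT hT hE tV fEn EnE hEn cP coP (SP _ Ss0) _ fS SP ES.
  by move=> e Ee es0; have : (e `&` S) s0 by []; rewrite ES.
exists Y; split => //; last exact: nA'.
by split => //; exists s0.
Qed.

Lemma bigcup_fgraph (D : set (set T)) (Y : set T -> set T) : finite_set D ->
  (forall P, D P -> @fgraph R T (Y P)) ->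
  (forall P Q, D P -> D Q -> P <> Q -> Y P `&` Y Q = set0) ->
  @fgraph R T (\bigcup_(P in D) Y P).
Proof.
move=> fD; elim/finite_set_ind : D / fD => [_ _|P D fD nDP IH gD tD].
  by rewrite bigcup_set0; exact: fgraph0.
rewrite bigcup_setU bigcup_set1; apply: fgraphU.
- by apply: gD; left.
- by apply: IH => [Q DQ|Q1 Q2 DQ1 DQ2 Q12]; [apply: gD|apply: tD => //]; right.
- rewrite -subset0 => x [Px [Q DQ Qx]]; rewrite -(tD P Q) //; [by left|by right|].
  by move=> PQ; apply: nDP; rewrite PQ.
Qed.

Lemma adjoin_edges_fgraph (E' : set (set T)) Y : finite_set E' -> E' `<=` E ->
  @fgraph R T Y -> (forall e, E' e -> e `&` Y = set0 /\ closure e `\` e `<=` Y) ->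
  @fgraph R T (Y `|` \bigcup_(e in E') closure e).
Proof.
move=> fE'; elim/finite_set_ind : E' / fE' => [_ gY _|e E' fE' nE'e IH E'E gY E'Y].
  by rewrite bigcup_set0 setU0.
rewrite bigcup_setU bigcup_set1 (setUC (closure e)) setUA.
have [eE tE] := hE; have Ee : E e by apply: E'E; left.
have [f [a [b [hA eE']]]] := edge_arc cptT (eE e Ee).
have [bE [na nb ab]] := edge_bnd hA eE'.
have [eY beY] := E'Y e (or_introl erefl).
apply: (fgraph_arc _ hA).
  by apply: IH => // z E'z; [apply: E'E|apply: E'Y]; right.
have e_e' : e `&` \bigcup_(e' in E') closure e' = set0.
  rewrite -subset0 => x [ex [e' E'e' e'x]].
  have oe : open e by case: (eE e Ee).
  have : (closure e' `&` e) x by [].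
  rewrite (closure_disjoint oe) // -subset0 => y [e'y ey].
  apply: nE'e; rewrite (tE e e') //; first by apply: E'E; right.
  by exists y.
rewrite bE; apply/seteqP; split=> x.
  case=> -[ex|//] [Yx|E'x].
    by have : (e `&` Y) x by []; rewrite eY.
  by have : (e `&` \bigcup_(e' in E') closure e') x by []; rewrite e_e'.
move=> abx; split; first by right.
left; apply: beY; rewrite bE; split; first by right.
by case: abx => ->.
Qed.

(* The clause on arcs keeps the leaves of the space: a leaf may be a component of
   its own after removing some edges, and a tree through the ends of [E'] could
   miss it. *)
Lemma finite_subgraph (E' : set (set T)) D : finite_set E' -> E' `<=` E ->
  pieces ([set: T] `\` \bigcup_(e in E') e) D ->
  exists G, [/\ @fgraph R T G, forall e, E' e -> closure e `<=` G &
    forall P, D P -> [/\ connected (G `&` P), G `&` P !=set0 &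
      forall A f a b, is_arc A f a b -> P `<=` A -> P `<=` G]].
Proof.
move=> fE' E'E pD; have [fD hD tD DE] := pD; have [eE tE] := hE.
(* The ends of removed edges lying in [P]. They avoid all edges of [E], since these are open and
   disjoint, so they may be used as ends in [finite_tree]. *)
pose S P := P `&` \bigcup_(e in E') (closure e `\` e).
have fin e : E' e -> finite_set (closure e `\` e).
  move=> E'e; have ele := edge_edge_like cptT (eE e (E'E _ E'e)).
  have [u [v [h _ _ _ _]]] := edge_like_bnd ele.
  exact: sub_finite_set h (finite_set2 _ _).
have fS P : finite_set (S P).
  apply: (@sub_finite_set _ _ (\bigcup_(e in E') (closure e `\` e))).
    exact: subIsetr.
  exact: bigcup_finite.
have ES P e : E e -> e `&` S P = set0.
  move=> Ee; rewrite -subset0 => x [ex [_ [e' E'e' [ce'x ne'x]]]].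
  have oe : open e by case: (eE e Ee).
  have : (closure e' `&` e) x by [].
  rewrite (closure_disjoint oe) // -subset0 => y [e'y ey].
  apply: ne'x; rewrite (tE e' e) //; first exact: E'E.
  by exists y.
have /choice[Y hY] : forall P, exists Y, D P ->
    [/\ Y `<=` P, closed Y /\ connected Y, Y !=set0 /\ S P `<=` Y, @fgraph R T Y &
      forall A f a b, is_arc A f a b -> P `<=` A -> Y = P].
  move=> P; have [DP|nDP] := pselect (D P); last by exists set0.
  have [cP coP P0] := hD P DP.
  have [|Y HY] := piece_fgraph cP coP P0 (fS P) _ (ES P); first exact: subIsetl.
  by exists Y.
have YP P : D P -> Y P `<=` P by move=> /hY[].
have PE' P : D P -> P `<=` [set: T] `\` \bigcup_(e in E') e.
  by move=> DP; rewrite DE => x Px; exists P.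
have SY x : (\bigcup_(e in E') (closure e `\` e)) x -> exists2 P, D P & Y P x.
  move=> [e E'e [cex nex]].
  have : ([set: T] `\` \bigcup_(e in E') e) x.
    split => // -[e' E'e' e'x]; have : (e' `&` S setT) x.
      by split => //; split => //; exists e.
    by rewrite ES//; exact: E'E.
  rewrite DE => -[P DP Px]; exists P => //.
  by have [_ _ [_ SPY] _ _] := hY P DP; apply: SPY; split => //; exists e.
pose G := \bigcup_(P in D) Y P `|` \bigcup_(e in E') closure e.
(* The closure of a removed edge adds to [P] only ends of that edge, and these already belong to
   [Y P]. *)
have GP P : D P -> G `&` P = Y P.
  move=> DP; apply/seteqP; split=> [x [Gx Px]|x Yx]; last first.
    by split; [left; exists P|exact: YP Yx].
  have Pq Q : D Q -> Q x -> Q = P by move=> DQ Qx; apply: tD => //; exists x.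
  case: Gx => [[Q DQ QYx]|[e E'e cex]].
    by rewrite -(Pq Q DQ (YP Q DQ _ QYx)).
  have [|Q DQ QYx] := SY x.
    exists e => //; split => // ex; have [_] := PE' P DP x Px; apply.
    by exists e.
  by rewrite -(Pq Q DQ (YP Q DQ _ QYx)).
exists G; split.
- apply: adjoin_edges_fgraph => //.
    apply: bigcup_fgraph => // [P /hY[]//|P Q DP DQ PQ].
    rewrite -subset0 => x [/(YP P DP) Px /(YP Q DQ) Qx]; apply: PQ.
    by apply: tD => //; exists x.
  move=> e E'e; split.
    rewrite -subset0 => x [ex [P DP /(YP P DP)/(PE' P DP)[_]]]; apply.
    by exists e.
  by move=> x xe; have [|P DP Px] := SY x; [exists e|exists P].
- by move=> e E'e x ex; right; exists e.
- move=> P DP; rewrite GP//; have [h1 [h2 h3] [h4 h5] h6 h7] := hY P DP; split => //.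
  move=> A f a b hA PA x Px; left; exists P => //.
  by rewrite (h7 A f a b).
Qed.

End subgraphs.

(** * End segments of an edge and extension of separations *)

Section end_segments.
Context {R : realType} {T : topologicalType}.
Context (cptT : compact [set: T]).
Implicit Types (A B C G I N P Z : set T) (f : T -> R) (D E F : set (set T)).

(* [J b] runs from the endpoint [a b] of the edge [I] to the point [x b] of [e];
   what lies between the two segments is inside [e]. *)
Definition end_segments I e (J : bool -> set T) (a x : bool -> T) :=
  [/\ forall b, exists f u v, @is_arc R T (J b) f u v,
      forall b, [/\ J b (a b), J b (x b), e (x b) & x b <> a b],
      forall b y, J b y -> y = a b \/ I y,
      J false `&` J true = set0 &
      (forall b, closure I (a b) /\ ~ I (a b)) /\
      forall y, I y -> e y \/ exists b, J b y].

Lemma end_segments_exist I e : edge R I -> open e -> I `&` e !=set0 ->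
  exists (J : bool -> set T) (a x : bool -> T), end_segments I e J a x.
Proof.
move=> hI oe [z [Iz ez]]; have [f [a [b [hA IE]]]] := edge_arc cptT hI.
have [cA cf If fA [Aa Ab fa fb]] := hA.
have [bE [na nb ab]] := edge_bnd hA IE.
have sI := @subset_closure _ I.
have If01 y : I y -> 0 < f y < 1 by rewrite IE => -[].
have fI01 y : closure I y -> 0 < f y < 1 -> I y by move=> cy fy; rewrite IE.
(* The levels at which the closure of [I] leaves [e] form a closed set. A band of levels around
   [f z] avoids it, and the band limits [t1] and [t2] are where the two end segments stop. *)
pose K := f @` (closure I `\` e).
have cK : closed K.
  apply: compact_closed; first exact: Rhausdorff.
  apply: continuous_compact; first by apply: continuous_subspaceW cf => y [].
  by apply: closed_cpt => //; apply: closedI => //; exact: open_closedC.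
have nKz : ~ K (f z).
  by move=> [y [cy ney] fyz]; apply: ney; rewrite (_ : y = z) //; apply: If => //; exact: sI.
have /nbhs_ballP[d /= d0 dK] : nbhs (f z) (~` K `&` `]0, 1[%classic).
  apply: open_nbhs_nbhs; split; last by split=> //; rewrite /= in_itv /=; exact: If01.
  by apply: openI; [exact: closed_openC|exact: interval_open].
have near r : `|f z - r| <= d / 2 -> ~ K r /\ 0 < r < 1.
  move=> zr; have [] : (~` K `&` `]0, 1[%classic) r.
    apply: dK; rewrite /ball /=; apply: le_lt_trans zr _.
    by rewrite ltr_pdivrMr// ltr_pMr// ltr1n.
  by rewrite /= in_itv.
pose t1 := f z - d / 2; pose t2 := f z + d / 2.
have d20 : 0 < d / 2 by rewrite divr_gt0.
have [n1 /andP[t10 t11]] : ~ K t1 /\ 0 < t1 < 1.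
  by apply: near; rewrite /t1 subKr gtr0_norm.
have [n2 /andP[t20 t21]] : ~ K t2 /\ 0 < t2 < 1.
  by apply: near; rewrite /t2 opprD addNKr normrN gtr0_norm.
have t12 : t1 < t2 by rewrite /t1 /t2; lra.
have mid y : closure I y -> t1 <= f y <= t2 -> e y.
  move=> cy /andP[y1 y2]; apply: contrapT => ney.
  have [+ _] : ~ K (f y) /\ 0 < f y < 1.
    by apply: near; rewrite ler_norml; move: y1 y2; rewrite /t1 /t2; lra.
  by apply; exists y.
have [|x1 Ax1 fx1] := arc_preimage hA (t := t1); first by rewrite !ltW.
have [|x2 Ax2 fx2] := arc_preimage hA (t := t2); first by rewrite !ltW.
have ax1 : f a < f x1 by rewrite fa fx1.
have xb2 : f x2 < f b by rewrite fb fx2.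
have h1 := subarc hA Aa Ax1 ax1; have h2 := subarc hA Ax2 Ab xb2.
exists (fun c => if c then closure I `&` f @^-1` `[f x2, f b]
                 else closure I `&` f @^-1` `[f a, f x1]).
exists (fun c => if c then b else a), (fun c => if c then x2 else x1).
split.
- by case; [exists (fun y => (f y - f x2) / (f b - f x2)), x2, b
           |exists (fun y => (f y - f a) / (f x1 - f a)), a, x1].
- have [_ _ _ _ [? ? _ _]] := h1; have [_ _ _ _ [? ? _ _]] := h2.
  case; split => //.
  + by apply: mid => //; rewrite fx2 lexx ltW.
  + by move=> xb; move: xb2; rewrite xb ltxx.
  + by apply: mid => //; rewrite fx1 lexx ltW.
  + by move=> xa; move: ax1; rewrite xa ltxx.
- case=> y [cy] /=; rewrite in_itv /= => /andP[y1 y2].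
    have [fy|fy] := eqVneq (f y) 1; first by left; apply: If; rewrite // fb.
    right; apply: fI01 => //; move: y1 y2; rewrite fx2 fb => y1 y2.
    by rewrite (lt_le_trans t20 y1) lt_neqAle fy.
  have [fy|fy] := eqVneq (f y) 0; first by left; apply: If; rewrite // fa.
  right; apply: fI01 => //; move: y1 y2; rewrite fx1 fa => y1 y2.
  by rewrite (le_lt_trans y2 t11) andbT lt_neqAle eq_sym fy.
- rewrite -subset0 => y [[_ /=]]; rewrite in_itv /= => /andP[_ y1] [_ /=].
  rewrite in_itv /= => /andP[y2 _]; have := le_trans y2 y1.
  by rewrite fx1 fx2 leNgt t12.
- split; first by case; split.
  move=> y Iy; have /andP[y0 y1] := If01 y Iy; have cy := sI y Iy.
  have [yt|ty] := leP (f y) t1.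
    by right; exists false; split => //=; rewrite in_itv /= fa fx1 (ltW y0).
  have [yt|ty'] := leP t2 (f y).
    by right; exists true; split => //=; rewrite in_itv /= fb fx2 (ltW y1) yt.
  by left; apply: mid => //; rewrite !ltW.
Qed.

(* Since [G] meets each piece of the complement in a connected set, a
   separation of [G] inside a union [Z] of pieces and of points of [G] extends
   to a separation of [Z]. *)
Lemma extend_separation (E' : set (set T)) D G Z A B :
  pieces ([set: T] `\` \bigcup_(e in E') e) D -> (forall e, E' e -> e `<=` G) ->
  (forall P, D P -> connected (G `&` P)) ->
  (forall P, D P -> P `<=` Z \/ P `&` Z = set0) ->
  closed A -> closed B -> A `&` B = set0 -> G `&` Z = A `|` B ->
  exists A' B', [/\ closed A' /\ closed B', A' `&` B' = set0, A' `|` B' = Z,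
    A `<=` A' & B `<=` B'].
Proof.
move=> [fD hD tD DE] E'G DG DZ cA cB AB GZ.
pose DA := [set P | [/\ D P, P `<=` Z & P `&` A !=set0]].
pose DB := [set P | [/\ D P, P `<=` Z & P `&` A = set0]].
have fDA : finite_set DA by apply: sub_finite_set fD => P [].
have fDB : finite_set DB by apply: sub_finite_set fD => P [].
have clD D' : finite_set D' -> (forall P, D' P -> D P) -> closed (\bigcup_(P in D') P).
  by move=> fD' D'D; apply: closed_bigcup => // P /D'D/hD[].
have AG : A `<=` G by move=> x; at_point x.
have BG : B `<=` G by move=> x; at_point x.
exists (A `|` \bigcup_(P in DA) P), (B `|` \bigcup_(P in DB) P); split.
- by split; apply: closedU => //; apply: clD => // P [].
- rewrite -subset0 => x [[Ax|[P [DP PZ [y [Py Ay]]] Px]] [Bx|[Q [DQ QZ QA] Qx]]].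
  + by have : (A `&` B) x by []; rewrite AB.
  + by have : (Q `&` A) x by []; rewrite QA.
  + have [||GPA|GPB] := connected_closedU (DG P DP) cA cB.
    * by move=> w [Gw Pw]; have := PZ w Pw; at_point w.
    * by rewrite AB setI0.
    * have Ax : A x by apply: GPA; split => //; exact: BG.
      by have : (A `&` B) x by []; rewrite AB.
    * have By : B y by apply: GPB; split => //; exact: AG.
      by have : (A `&` B) y by []; rewrite AB.
  + have PQ : P = Q by apply: tD => //; exists x.
    by have : (Q `&` A) y by [rewrite -PQ]; rewrite QA.
- apply/seteqP; split=> x.
    have AZ : A `<=` Z by move=> w; at_point w.
    have BZ : B `<=` Z by move=> w; at_point w.
    by case=> -[h|[P [_ PZ _] /PZ]] //; [exact: AZ|exact: BZ].
  move=> Zx; have [[e E'e ex]|nx] := pselect ((\bigcup_(e in E') e) x).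
    have : (A `|` B) x by rewrite -GZ; split => //; exact: E'G ex.
    by case; [left|right]; left.
  have : ([set: T] `\` \bigcup_(e in E') e) x by [].
  rewrite DE => -[P DP Px].
  have PZ : P `<=` Z.
    by have [//|PZ] := DZ P DP; have : (P `&` Z) x by []; rewrite PZ.
  have [PA|/set0P/negP/negPn/eqP PA] := pselect (P `&` A !=set0); [left|right];
    by right; exists P.
- exact: subsetUl.
- exact: subsetUl.
Qed.

End end_segments.

(** * Components left by an arbitrary finite edge-set *)

Section main_theorem.
Context {R : realType} {T : topologicalType}.
Context (cptT : compact [set: T]) (hT : hausdorff_space T).
Implicit Types (A B C G N P Z : set T) (f : T -> R) (D E F : set (set T)).

(** Otherwise [I] would be a connected subset with more than one point in a totally disconnected
    set; the levels 1/2 and 1/3 supply two points. *)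
Lemma edge_meets E I : totally_disconnected ([set: T] `\` \bigcup_(e in E) e) ->
  edge R I -> exists2 e, E e & I `&` e !=set0.
Proof.
move=> tV hI; apply: contrapT => nE.
have [f [a [b [hA IE]]]] := edge_arc cptT hI.
have [_ coI _ _] := edge_edge_like cptT hI.
have [x clx fx] := arc_preimage hA (t := 1 / 2) ltac:(by apply/andP; split; lra).
have [y cly fy] := arc_preimage hA (t := 1 / 3) ltac:(by apply/andP; split; lra).
have Ix : I x by rewrite IE; split => //=; rewrite fx; apply/andP; split; lra.
have Iy : I y by rewrite IE; split => //=; rewrite fy; apply/andP; split; lra.
have IV : I `<=` [set: T] `\` \bigcup_(e in E) e.
  by move=> z Iz; split => // -[e Ee ez]; apply: nE; exists e => //; exists z.
have : connected_component ([set: T] `\` \bigcup_(e in E) e) x y by exists I.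
rewrite tV; last exact: IV.
by move=> yx; move: fy; rewrite yx fx; lra.
Qed.

Lemma finite_subgraph_component E F C (E' : set (set T)) D G :
  edge_set R E -> totally_disconnected ([set: T] `\` \bigcup_(e in E) e) ->
  connected [set: T] -> edge_set R F -> finite_set F ->
  components ([set: T] `\` \bigcup_(I in F) I) C ->
  E' `<=` E -> pieces ([set: T] `\` \bigcup_(e in E') e) D -> closed G ->
  (forall e, E' e -> closure e `<=` G) ->
  (forall P, D P -> [/\ connected (G `&` P), G `&` P !=set0 &
      forall A f a b, is_arc A f a b -> P `<=` A -> P `<=` G]) ->
  (forall I, F I -> exists2 e, E' e & I `&` e !=set0) ->
  (exists2 e, E' e & e `&` C !=set0) \/ (forall e, E e -> e `&` C = set0) ->
  connected (G `&` C) /\ G `&` C !=set0.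
Proof.
move=> [eE tE] tV coT [eF tF] fF hC E'E pD cG E'G hG FE' CE.
have [fD hD tD DE] := pD.
have T0 : [set: T] !=set0 by case: hC => x _ _; exists x.
have [DF pDF] := pieces_edges coT T0 fF (fun I FI => edge_edge_like cptT (eF I FI)) tF.
have DC : DF C := component_piece pDF hC.
have [_ hDF tDF NE] := pDF; have [cC coC [c0 Cc0]] := hDF C DC.
pose M := \bigcup_(Q in DF `\ C) Q.
have cM : closed M by exact: pieces_rest_closed pDF.
have NCM x : ~ (\bigcup_(I in F) I) x -> C x \/ M x.
  move=> nx; have : ([set: T] `\` \bigcup_(I in F) I) x by [].
  rewrite NE => -[Q DQ Qx]; have [QC|QC] := pselect (Q = C); first by left; rewrite -QC.
  by right; exists Q.
have CF x I : F I -> I x -> ~ C x.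
  move=> FI Ix Cx; have : (\bigcup_(Q in DF) Q) x by exists C.
  by rewrite -NE => -[_]; apply; exists I.
have MF x I : F I -> I x -> ~ M x.
  move=> FI Ix [Q [DQ _] Qx]; have : (\bigcup_(Q in DF) Q) x by exists Q.
  by rewrite -NE => -[_]; apply; exists I.
have CM x : C x -> ~ M x.
  by move=> Cx [Q [DQ QC] Qx]; apply: QC; apply: tDF => //; exists x.
have /choice[q hq] : forall I, exists q : set T * (bool -> set T) * (bool -> T) * (bool -> T),
    F I -> E' q.1.1.1 /\ @end_segments R T I q.1.1.1 q.1.1.2 q.1.2 q.2.
  move=> I; have [FI|nFI] := pselect (F I); last first.
    by exists (set0, fun=> set0, fun=> c0, fun=> c0).
  have [e E'e Ie] := FE' I FI.
  have oe : open e by case: (eE e (E'E e E'e)).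
  have [J [a [x H]]] := end_segments_exist cptT (eF I FI) oe Ie.
  by exists (e, J, a, x).
(* One index for each end segment: an edge of [F] and one of its two ends. *)
pose K := F `*` [set: bool].
have fK : finite_set K by apply: finite_setX => //; exact: finite_finset.
pose J (k : set T * bool) := (q k.1).1.1.2 k.2.
pose a (k : set T * bool) := (q k.1).1.2 k.2.
pose x (k : set T * bool) := (q k.1).2 k.2.
have KP k : K k -> F k.1 by case.
have Jarc k : K k -> exists f u v, @is_arc R T (J k) f u v.
  by move=> /KP/hq[_ [h _ _ _ _]]; exact: h.
have Ja k : K k -> J k (a k) by move=> /KP/hq[_ [_ h _ _ _]]; case: (h k.2).
have Jx k : K k -> J k (x k) by move=> /KP/hq[_ [_ h _ _ _]]; case: (h k.2).
have xa k : K k -> x k <> a k by move=> /KP/hq[_ [_ h _ _ _]]; case: (h k.2).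
have Gx k : K k -> G (x k).
  move=> /KP/hq[E'e [_ h _ _ _]]; case: (h k.2) => _ _ ex _.
  by apply: (E'G _ E'e); exact: subset_closure.
have JI k y : K k -> J k y -> y = a k \/ k.1 y.
  by move=> /KP/hq[_ [_ _ h _ _]]; exact: h.
have J01 k k' y : K k -> k.1 = k'.1 -> J k y -> J k' y -> k = k'.
  case: k => I b; case: k' => I' b' [/= FI _] /= II'; rewrite -{}II' /J /=.
  have [_ [_ _ _ + _]] := hq I FI; rewrite -subset0 => h.
  by case: b b' => -[] // h1 h2; case: (h y).
have aF k : K k -> ~ (\bigcup_(I in F) I) (a k).
  move=> Kk; have [_ [_ _ _ _ [+ _]]] := hq _ (KP k Kk).
  move=> /(_ k.2)[cla nIa] [I' FI' I'a]; apply: nIa.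
  have oI' : open I' by case: (eF I' FI').
  have [y [ky I'y]] := cla I' (open_nbhs_nbhs (conj oI' I'a)).
  suff I'k : I' = k.1 by rewrite I'k in I'a.
  by apply: tF => //; [exact: KP|exists y].
have JN k y : K k -> J k y -> ~ (\bigcup_(I in F) I) y -> y = a k.
  by move=> Kk Jy ny; case: (JI k y Kk Jy) => // ky; case: ny; exists k.1 => //; exact: KP.
have CN y : C y -> ~ (\bigcup_(I in F) I) y by move=> Cy [I FI Iy]; exact: CF Iy Cy.
have MN y : M y -> ~ (\bigcup_(I in F) I) y by move=> My [I FI Iy]; exact: MF Iy My.
(* Segments of different edges are disjoint inside the edges, and the two segments of one edge are
   disjoint altogether; so distinct segments can only meet in a common end. *)
have JJ k k' y : K k -> K k' -> k <> k' -> J k y -> J k' y -> y = a k /\ y = a k'.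
  move=> Kk Kk' kk' Jy J'y.
  have [[I FI Iy]|ny] := pselect ((\bigcup_(I in F) I) y); last first.
    by split; [exact: JN|exact: JN].
  exfalso; apply: kk'; apply: (J01 k k' y) => //.
  have h k0 : K k0 -> J k0 y -> k0.1 = I.
    move=> Kk0 J0y; case: (JI k0 y Kk0 J0y) => [yak|k0y].
      by case: (aF k0 Kk0); rewrite -yak; exists I.
    by apply: tF => //; [exact: KP|exists y].
  by rewrite h// h.
have cover y : C y \/ M y \/ (exists2 k, K k & J k y) \/ (\bigcup_(e in E') e) y.
  have [[I FI Iy]|ny] := pselect ((\bigcup_(I in F) I) y); last first.
    by case: (NCM y ny); [left|right; left].
  right; right; have [E'e [_ _ _ _ [_ h]]] := hq I FI.
  case: (h y Iy) => [ey|[b Jy]]; first by right; exists (q I).1.1.1.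
  by left; exists (I, b).
have cJ k : K k -> closed (J k) by move=> /Jarc[f [u [v []]]].
have coJ k : K k -> connected (J k).
  move=> /Jarc[f [u [v hA]]]; rewrite -[J k]setIT -(preimage_setT f).
  by apply: (arc_connected cptT hA).
pose KC := [set k | K k /\ C (a k)]; pose KM := [set k | K k /\ M (a k)].
have cU (K' : set (set T * bool)) : (forall k, K' k -> K k) ->
    closed (\bigcup_(k in K') J k).
  move=> K'K; apply: closed_bigcup => [|k /K'K]; last exact: cJ.
  exact: sub_finite_set fK.
have cUG (K' : set (set T * bool)) : (forall k, K' k -> K k) ->
    closed (\bigcup_(k in K') (J k `&` G)).
  move=> K'K; apply: closed_bigcup => [|k /K'K Kk]; first exact: sub_finite_set fK.
  by apply: closedI => //; exact: cJ.
(* [C] with all the end segments attached to it: this is a union of pieces of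
   the complement of [E'] and of points of [E']. *)
pose C' := C `|` \bigcup_(k in KC) J k; pose M' := M `|` \bigcup_(k in KM) J k.
have CM' : C' `&` M' = set0.
  rewrite -subset0 => y [[Cy|[k [Kk Ca] Jy]] [My|[k' [Kk' Ma] J'y]]].
  - exact: CM My.
  - by apply: (CM y Cy); rewrite (JN k' y Kk' J'y (CN y Cy)).
  - by apply: (CM (a k) Ca); rewrite -(JN k y Kk Jy (MN y My)).
  - have kk' : k <> k' by move=> kk'; rewrite kk' in Ca; exact: CM Ma.
    have [yk yk'] := JJ k k' y Kk Kk' kk' Jy J'y.
    by apply: (CM _ Ca); rewrite -yk yk'.
(* A piece avoids [E'], so by [cover] it lies in the union of the disjoint closed sets [C'] and
   [M'], and being connected it lies in one of them. *)
have PC P : D P -> P `<=` C' \/ P `&` C' = set0.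
  move=> DP; have [cP coP _] := hD P DP.
  have cC' : closed C' by apply: closedU => //; apply: cU => k [].
  have cM' : closed M' by apply: closedU => //; apply: cU => k [].
  have [|||PM] := connected_closedU coP cC' cM'.
  - move=> y Py; have ny : ~ (\bigcup_(e in E') e) y.
      by have : ([set: T] `\` \bigcup_(e in E') e) y; [rewrite DE; exists P|case].
    have [Cy|[My|[[k Kk Jy]|//]]] := cover y; [by left; left|by right; left|].
    by have [Ca|Ma] := NCM _ (aF k Kk); [left|right]; right; exists k.
  - by rewrite CM' setI0.
  - by left.
  - by right; apply/seteqP; split=> y; at_point y.
have E'G' e : E' e -> e `<=` G.
  by move=> E'e y ey; apply: (E'G e E'e); exact: subset_closure.
have extend A B := @extend_separation T E' D G C' A B pD E'G'
  (fun P DP => let: And3 h _ _ := hG P DP in h) PC.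
have GC : connected (G `&` C).
  apply: closed_connectedP; first exact: closedI.
  move=> A B cA cB AB GAB [y0 Ay0] [y1 By1].
  (* Each segment joins the half that contains its end. A segment whose end is not in [G] is free to
     join either half and is assigned to [A]. *)
  pose KA := [set k | KC k /\ ~ B (a k)]; pose KB := [set k | KC k /\ B (a k)].
  have AC y : A y -> C y by move=> Ay; have : (G `&` C) y; [rewrite GAB; left|case].
  have BC y : B y -> C y by move=> By; have : (G `&` C) y; [rewrite GAB; right|case].
  have [||||A' [B' [[cA' cB'] A'B' A'B'C AA' BB']]] :=
      extend (A `|` \bigcup_(k in KA) (J k `&` G)) (B `|` \bigcup_(k in KB) (J k `&` G)).
  - by apply: closedU => //; apply: cUG => k [[]].
  - by apply: closedU => //; apply: cUG => k [[]].
  - rewrite -subset0 => y [[Ay|[k [[Kk Ca] nBa] [Jy _]]] [By|[k' [[Kk' Ca'] Ba] [J'y _]]]].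
    + by have : (A `&` B) y by []; rewrite AB.
    + have yk := JN k' y Kk' J'y (CN y (AC y Ay)); rewrite -yk in Ba.
      by have : (A `&` B) y by []; rewrite AB.
    + by have yk := JN k y Kk Jy (CN y (BC y By)); rewrite -yk in nBa.
    + have kk' : k <> k' by move=> kk'; rewrite kk' in nBa.
      have [yk yk'] := JJ k k' y Kk Kk' kk' Jy J'y.
      by apply: nBa; rewrite -yk yk'.
  - apply/seteqP; split=> y.
      move=> [Gy [Cy|[k KCk Jy]]].
        have : (A `|` B) y by rewrite -GAB.
        by case; [left|right]; left.
      by have [Ba|nBa] := pselect (B (a k)); [right|left]; right; exists k.
    have sub : (A `|` B) y -> (G `&` C') y by rewrite -GAB => -[Gy Cy]; split => //; left.
    case=> [[Ay|[k [KCk _] [Jy Gy]]]|[By|[k [KCk _] [Jy Gy]]]].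
    + by apply: sub; left.
    + by split => //; right; exists k.
    + by apply: sub; right.
    + by split => //; right; exists k.
  have [|||] := connected_closedU coC cA' cB'.
  - by rewrite A'B'C => y Cy; left.
  - by rewrite A'B' setI0.
  - move=> CA'; have : (A' `&` B') y1.
      by split; [apply: CA'; exact: BC|apply: BB'; left].
    by rewrite A'B'.
  - move=> CB'; have : (A' `&` B') y0.
      by split; [apply: AA'; left|apply: CB'; exact: AC].
    by rewrite A'B'.
split => //.
case: CE => [[e E'e [y [ey Cy]]]|CE].
  by exists y; split => //; exact: E'G' ey.
(* Here [C] is a single point [c0]. *)
have CV : C `<=` [set: T] `\` \bigcup_(e in E) e.
  by move=> y Cy; split => // -[e Ee ey]; have : (e `&` C) y by []; rewrite CE.
have Cc y : C y -> y = c0.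
  move=> Cy; have : connected_component ([set: T] `\` \bigcup_(e in E) e) c0 y by exists C.
  by rewrite tV; last exact: CV.
exists c0; split => //; apply: contrapT => nGc.
have [P DP Pc0] : (\bigcup_(P in D) P) c0.
  by rewrite -DE; split => // -[e E'e ec0]; apply: nGc; exact: E'G' ec0.
have PC' : P `<=` C'.
  by have [//|PC0] := PC P DP; have : (P `&` C') c0 by [split => //; left]; rewrite PC0.
have [_ [y0 [Gy0 Py0]] arcP] := hG P DP.
(* The graph meets the piece of [c0], but not at [c0]; hence it does so on some end segment [i]
   starting at [c0]. *)
have [i KCi Jiy0] : (\bigcup_(k in KC) J k) y0.
  by case: (PC' y0 Py0) => // /Cc y0c; case: nGc; rewrite -y0c.
have aC k : KC k -> a k = c0 by move=> [_ /Cc].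
pose Ki := [set k | KC k /\ k <> i].
have [Ki_i cKi] := (KCi, KCi).
(* The segments at [c0] meet only in [c0], which is missing from [G], so [G] is separated into its
   part on segment [i] and its part on the others. In the extension segment [i] carries [c0] into
   [A']. Another segment [k] would lie in [B'] because of the point [x k] of [G], yet it contains
   [c0] too. *)
have [||||A' [B' [[cA' cB'] A'B' A'B'C AA' BB']]] :=
    extend (J i `&` G) (\bigcup_(k in Ki) (J k `&` G)).
- by apply: closedI => //; apply: cJ; case: KCi.
- by apply: cUG => k [[]].
- rewrite -subset0 => y [[Jy Gy] [k [KCk ki] [Jky _]]].
  have [yk _] := JJ k i y KCk.1 KCi.1 ki Jky Jy.
  by apply: nGc; rewrite -(aC k KCk) -yk.
- apply/seteqP; split=> y.
    move=> [Gy [Cy|[k KCk Jy]]]; first by case: nGc; rewrite -(Cc y Cy).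
    have [ki|ki] := pselect (k = i); first by left; rewrite -ki.
    by right; exists k.
  by case=> [[Jy Gy]|[k [KCk _] [Jy Gy]]]; split => //; right; [exists i|exists k].
have side k : KC k -> J k `<=` A' \/ J k `<=` B'.
  move=> KCk; apply: connected_closedU => //; first by apply: coJ; case: KCk.
    by rewrite A'B'C => y Jy; right; exists k.
  by rewrite A'B' setI0.
have A'c0 : A' c0.
  have [JA|JB] := side i KCi; first by apply: JA; rewrite -(aC i KCi); apply: Ja; case: KCi.
  have : (A' `&` B') y0 by split; [apply: AA'|apply: JB].
  by rewrite A'B'.
have only k : KC k -> k = i.
  move=> KCk; apply: contrapT => ki; have [Kk _] := KCk.
  have B'x : B' (x k) by apply: BB'; exists k => //; split; [exact: Jx|exact: Gx].
  have [JA|JB] := side k KCk.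
    by have : (A' `&` B') (x k); [split => //; apply: JA; exact: Jx|rewrite A'B'].
  have : (A' `&` B') c0; last by rewrite A'B'.
  by split => //; apply: JB; rewrite -(aC k KCk); exact: Ja.
have PJ : P `<=` J i.
  move=> y /PC'[/Cc->|[k /only->//]].
  by rewrite -(aC i KCi); apply: Ja; case: KCi.
have [f [u [v hA]]] := Jarc i KCi.1.
exact: nGc (arcP _ _ _ _ hA PJ c0 Pc0).
Qed.

End main_theorem.

Theorem theorem3p1 (R : realType) (X : topologicalType)
    (cX : continuum R X) (gX : graph_like R X) :
  exists G : nat -> set X,
    (forall n, finite_graph R (set_type (G n))) /\
    (forall F : set (set X), edge_set R F -> finite_set F ->
     forall C : set X, components ([set: X] `\` \bigcup_(I in F) I) C ->
       \forall n \near \oo,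
         exists! D : set X,
           components (G n `\` \bigcup_(I in F) I) D /\ D `&` C !=set0).
Proof.
have [cptX coX X0 mX] := cX; have [E hE tV] := gX.
have hX := metrizable_hausdorff mX.
have [eE tE] := hE.
have ele e : E e -> edge_like e by move=> /eE; exact: edge_edge_like.
have [|En [fEn EnE Enm hEn]] := edge_exhaustion mX cptX tE.
  by move=> e /ele[].
have sub_pieces n : exists D, pieces ([set: X] `\` \bigcup_(e in En n) e) D.
  apply: pieces_edges => // [e /EnE/ele//|].
  exact: sub_trivIset tE.
have /choice[Dn hDn] := sub_pieces.
have /choice[G hG] : forall n, exists G, [/\ @fgraph R X G,
    forall e, En n e -> closure e `<=` G &
    forall P, Dn n P -> [/\ connected (G `&` P), G `&` P !=set0 &
      forall A (f : X -> R) a b, is_arc A f a b -> P `<=` A -> P `<=` G]].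
  by move=> n; exact: (finite_subgraph cptX hX hE tV fEn EnE hEn).
exists G; split=> [n|F hF fF C hC].
  by have [gG _ _] := hG n; have [] := fgraph_finite_graph cptX hX gG.
have [eF tF] := hF.
(* As [F] is finite and the sets [En n] increase, one index serves all edges of [F]. *)
have Fn : exists N, forall I, F I -> exists2 e, En N e & I `&` e !=set0.
  have sub (F' : set (set X)) : finite_set F' -> F' `<=` F ->
      exists N, forall I, F' I -> exists2 e, En N e & I `&` e !=set0.
    move=> fF'; elim/finite_set_ind : F' / fF' => [|I F' _ _ IH] F'F.
      by exists 0%N.
    have [|N hN] := IH; first by move=> J F'J; apply: F'F; right.
    have hI : edge R I by apply: eF; apply: F'F; left.
    have [e Ee Ie] := edge_meets cptX tV hI.
    have [m me] := hEn e Ee; exists (maxn N m) => J [->|F'J].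
      by exists e => //; apply: Enm me; exact: leq_maxr.
    by have [e' Ne' Je'] := hN J F'J; exists e' => //; apply: Enm Ne'; exact: leq_maxl.
  exact: sub fF _.
have [N hN] := Fn.
have [M hM] : exists M, (exists2 e, En M e & e `&` C !=set0) \/
    (forall e, E e -> e `&` C = set0).
  have [[e Ee eC]|nE] := pselect (exists2 e, E e & e `&` C !=set0).
    by have [M Me] := hEn e Ee; exists M; left; exists e.
  exists 0%N; right => e Ee; apply: contrapT => /eqP/set0P eC; apply: nE.
  by exists e.
exists (maxn N M) => // n /= nNM.
have nN : (N <= n)%N by apply: leq_trans nNM; exact: leq_maxl.
have nM : (M <= n)%N by apply: leq_trans nNM; exact: leq_maxr.
have [gG eG pG] := hG n.
have [_ cG] := fgraph_finite_graph cptX hX gG.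
have [||coGC [x [Gx Cx]]] :=
    finite_subgraph_component cptX hE tV coX hF fF hC (EnE n) (hDn n) cG eG pG.
- by move=> I FI; have [e Ne Ie] := hN I FI; exists e => //; exact: Enm Ne.
- by case: hM => [[e Me eC]|]; [left; exists e => //; exact: Enm Me|right].
have CF : C `<=` [set: X] `\` \bigcup_(I in F) I.
  by case: hC => y _ <-; exact: connected_component_sub.
(* Any component meeting [C] meets the connected set [G n] within [C], which avoids [F]; so all such
   components are the one of [x]. *)
have GCF : G n `&` C `<=` G n `\` \bigcup_(I in F) I by move=> y [Gy /CF[]].
exists (connected_component (G n `\` \bigcup_(I in F) I) x); split.
  split; first by exists x => //; exact: GCF.
  by exists x; split => //; apply: connected_component_refl; exact: GCF.
move=> _ [[y GFy <-] [z [yz Cz]]].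
have [Gz _] := connected_component_sub yz.
rewrite (same_connected_component yz); apply: same_connected_component.
by exists (G n `&` C).
Qed.
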